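(* Relative to the halting problem $\emptyset'$ the following equivalences hold: $$\mathsf{B}\equiv_{\mathrm{sW}}^{\emptyset'}\mathsf{K}_\geq\equiv_{\mathrm{W}}^{\emptyset'}\mathsf{G}\equiv_{\mathrm{sW}}^{\emptyset'}\mathsf{K}\equiv_{\mathrm{sW}}^{\emptyset'}\mathsf{C}_{\mathbb N}.$$
   Context: Weihrauch complexity. $f:\subseteq X\rightrightarrows Y$ denotes a partial multivalued map. A represented space $(X,\delta_X)$ is a set $X$ with a surjective partial map $\delta_X:\subseteq\mathbb N^{\mathbb N}\to X$. A partial function $F:\subseteq\mathbb N^{\mathbb N}\to\mathbb N^{\mathbb N}$ is a realizer of $f:\subseteq X\rightrightarrows Y$, written $F\vdash f$, if $\delta_YF(p)\in f(\delta_X(p))$ for all $p\in\mathrm{dom}(f\delta_X)$. A problem is a multivalued map on represented spaces that has a realizer. $\mathbb N^{\mathbb N}$, $\mathbb N$ and products carry the standard representations; $\langle\cdot\rangle$ denotes standard pairing/tupling. For an oracle $q$, $f\leq_{\mathrm W}^{q}g$ holds if there are $H,L:\subseteq\mathbb N^{\mathbb N}\to\mathbb N^{\mathbb N}$, both computable relative to $q$, such that $H\langle\mathrm{id},\Gamma L\rangle\vdash f$ whenever $\Gamma\vdash g$; $f\leq_{\mathrm{sW}}^{q}g$ holds if there are $H,L$, both computable relative to $q$, such that $H\Gamma L\vdash f$ whenever $\Gamma\vdash g$. $\equiv_{\mathrm W}^{q}$ and $\equiv_{\mathrm{sW}}^{q}$ are the corresponding equivalences. Here $q=\emptyset'$ is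 the halting problem. Gödel problem and variants. $\varphi$ is a fixed standard (acceptable) Gödel numbering of the partial computable functions $\subseteq\mathbb N\to\mathbb N$. - $\mathsf{G}:\subseteq\mathbb N^{\mathbb N}\rightrightarrows\mathbb N$, $\mathsf{G}(p)=\{i\in\mathbb N:\varphi_i=p\}$, with domain the set of all (total) computable sequences $p\in\mathbb N^{\mathbb N}$. - $\mathsf{K}:\subseteq\mathbb N^{\mathbb N}\to\mathbb N$, $\mathsf{K}(p)=\min\mathsf{G}(p)$, $\mathrm{dom}(\mathsf K)=\mathrm{dom}(\mathsf G)$ (Kolmogorov complexity). - $\mathsf{K}_\geq:\subseteq\mathbb N^{\mathbb N}\rightrightarrows\mathbb N$, $\mathsf{K}_\geq(p)=\{m\in\mathbb N:m\geq\mathsf{K}(p)\}$, $\mathrm{dom}(\mathsf K_\geq)=\mathrm{dom}(\mathsf G)$. Other problems. - $\mathsf{B}:\subseteq\mathbb N^{\mathbb N}\rightrightarrows\mathbb N$, $\mathsf{B}(p)=\{m\in\mathbb N:(\forall n)\ p(n)\leq m\}$, defined on all bounded sequences. - $\mathsf{C}_{\mathbb N}:\subseteq\mathbb N^{\mathbb N}\rightrightarrows\mathbb N$, $\mathsf{C}_{\mathbb N}(p)=\{n\in\mathbb N:(\forall k)\ p(k)\neq n\}$, with domain $\{p:\mathrm{range}(p)\subsetneqq\mathbb N\}$ (closed choice). *)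

(* Defs.v *)
From Stdlib Require Import List Arith Classical ClassicalEpsilon.
Import ListNotations.

Definition baire : Type := nat -> nat.

Record partial_fun (A B : Type) : Type := PartialFun {
  pgraph :> A -> B -> Prop;
  pgraph_functional : forall a b b', pgraph a b -> pgraph a b' -> b = b'
}.

Lemma pcomp_functional {A B C : Type} (G : partial_fun B C) (F : partial_fun A B) :
  forall a c c', (exists b, F a b /\ G b c) -> (exists b, F a b /\ G b c') -> c = c'.
Proof.
  intros a c c' [b [Hb Hc]] [b' [Hb' Hc']].
  rewrite <- (pgraph_functional _ _ F _ _ _ Hb Hb') in Hc'.
  exact (pgraph_functional _ _ G _ _ _ Hc Hc').
Qed.

Definition pcomp {A B C : Type} (G : partial_fun B C) (F : partial_fun A B) :
    partial_fun A C :=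
  PartialFun A C (fun a c => exists b, F a b /\ G b c) (pcomp_functional G F).

(* The pairing <p,q>: p on the even positions, q on the odd ones. *)
Definition join (p q : baire) : baire :=
  fun n => if Nat.even n then p (Nat.div2 n) else q (Nat.div2 n).

Lemma id_paired_functional (F : partial_fun baire baire) :
  forall p r r', (exists q, F p q /\ r = join p q) ->
    (exists q, F p q /\ r' = join p q) -> r = r'.
Proof.
  intros p r r' [q [Hq ->]] [q' [Hq' ->]].
  rewrite (pgraph_functional _ _ F _ _ _ Hq Hq'). reflexivity.
Qed.

Definition id_paired (F : partial_fun baire baire) : partial_fun baire baire :=
  PartialFun baire baire (fun p r => exists q, F p q /\ r = join p q)
    (id_paired_functional F).

(* Codes of the mu-recursive functions with an oracle, over lists of arguments. *)

Inductive code : Type :=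
| Zero : code
| Succ : code
| Proj : nat -> code
| Oracle : code
| Comp : code -> list code -> code
| Prec : code -> code -> code
| Mu : code -> code.

Definition all2 {A B : Type} (R : A -> B -> Prop) : list A -> list B -> Prop :=
  fix all2 (s : list A) (t : list B) : Prop :=
    match s, t with
    | [], [] => True
    | a :: s', b :: t' => R a b /\ all2 s' t'
    | _, _ => False
    end.

(* [eval alpha c xs y]: the partial function with code [c] and oracle [alpha]
   is defined on the arguments [xs] and has value [y]. Codes carry no arity;
   when an argument is missing the value is undefined. *)
Fixpoint eval (alpha : baire) (c : code) (xs : list nat) (y : nat) : Prop :=
  match c with
  | Zero => y = 0
  | Succ => match xs with x :: _ => y = S x | [] => False end
  | Proj i => nth_error xs i = Some y
  | Oracle => match xs with x :: _ => y = alpha x | [] => False end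
  | Comp f gs =>
      exists ys, all2 (fun g z => eval alpha g xs z) gs ys /\ eval alpha f ys y
  | Prec f g =>
      match xs with
      | [] => False
      | n :: xs' =>
          (fix prec (n : nat) (y : nat) : Prop :=
             match n with
             | 0 => eval alpha f xs' y
             | S m => exists r, prec m r /\ eval alpha g (m :: r :: xs') y
             end) n y
      end
  | Mu f =>
      eval alpha f (y :: xs) 0 /\
      (forall k, k < y -> exists z, eval alpha f (k :: xs) (S z))
  end.

(* Evaluation without an oracle, i.e. with the constant zero oracle. *)
Definition eval0 : code -> list nat -> nat -> Prop := eval (fun _ => 0).

Definition computable_seq (p : baire) : Prop :=
  exists c, forall n, eval0 c [n] (p n).

(* As usual for functions on Baire space, nothing is required of the
   algorithm on inputs outside the domain of F. *)
Definition computable_rel (q : baire) (F : partial_fun baire baire) : Prop :=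
  exists c, forall p r, F p r -> forall n, eval (join q p) c [n] (r n).

(* Acceptable Goedel numberings in the sense of Rogers: the universal function
   is computable, and every computable binary partial function can be
   translated computably (s-m-n). *)
Record acceptable (phi : nat -> partial_fun nat nat) : Prop := {
  acceptable_universal :
    exists u, forall i n m, phi i n m <-> eval0 u [i; n] m;
  acceptable_smn :
    forall c, exists s, computable_seq s /\
      forall i n m, phi (s i) n m <-> eval0 c [i; n] m
}.

(* The characteristic function of {i : phi_i(i) is defined}. *)
Definition halting (phi : nat -> partial_fun nat nat) : baire :=
  fun i => if excluded_middle_informative (exists m, phi i i m) then 1 else 0.

Record rep_space : Type := RepSpace {
  carrier :> Type;
  delta : partial_fun baire carrier;
  delta_surjective : forall x, exists p, delta p x
}.

(* A partial multivalued map is a relation; its domain is the set of points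
   with at least one value. *)
Definition dom {X Y : Type} (f : X -> Y -> Prop) (x : X) : Prop := exists y, f x y.

Definition realizes_map (X Y : rep_space) (F : partial_fun baire baire)
    (f : X -> Y -> Prop) : Prop :=
  forall p x, delta X p x -> dom f x ->
    exists y, pcomp (delta Y) F p y /\ f x y.

Record problem : Type := Problem {
  source : rep_space;
  target : rep_space;
  pmap :> source -> target -> Prop;
  has_realizer : exists F, realizes_map source target F pmap
}.

Definition realizes (F : partial_fun baire baire) (f : problem) : Prop :=
  realizes_map (source f) (target f) F f.

Definition W_le (q : baire) (f g : problem) : Prop :=
  exists H L : partial_fun baire baire,
    computable_rel q H /\ computable_rel q L /\
    forall Gam : partial_fun baire baire,
      realizes Gam g -> realizes (pcomp H (id_paired (pcomp Gam L))) f.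

Definition sW_le (q : baire) (f g : problem) : Prop :=
  exists H L : partial_fun baire baire,
    computable_rel q H /\ computable_rel q L /\
    forall Gam : partial_fun baire baire,
      realizes Gam g -> realizes (pcomp H (pcomp Gam L)) f.

Definition W_equiv (q : baire) (f g : problem) : Prop := W_le q f g /\ W_le q g f.

Definition sW_equiv (q : baire) (f g : problem) : Prop := sW_le q f g /\ sW_le q g f.

(* By the axiom of choice every multivalued map has a realizer. *)
Lemma realizer_exists (X Y : rep_space) (f : X -> Y -> Prop) :
  exists F, realizes_map X Y F f.
Proof.
  pose (good := fun p r => exists x y, delta X p x /\ f x y /\ delta Y r y).
  pose (sel := fun p => epsilon (inhabits ((fun _ => 0) : baire)) (good p)).
  assert (Hfun : forall p r r',
            (good p r /\ r = sel p) -> (good p r' /\ r' = sel p) -> r = r').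
  { intros p r r' [_ ->] [_ ->]. reflexivity. }
  exists (PartialFun baire baire (fun p r => good p r /\ r = sel p) Hfun).
  intros p x Hx [y Hy].
  destruct (delta_surjective Y y) as [r Hr].
  assert (Hg : good p (sel p)).
  { apply epsilon_spec. exists r, x, y. auto. }
  destruct Hg as [x' [y' [Hx' [Hf Hy']]]].
  rewrite <- (pgraph_functional _ _ _ _ _ _ Hx Hx') in Hf.
  exists y'. split; [|exact Hf].
  exists (sel p). repeat split; [|exact Hy'].
  exists x, y'. auto.
Qed.

Definition problem_of (X Y : rep_space) (f : X -> Y -> Prop) : problem :=
  Problem X Y f (realizer_exists X Y f).

(* Baire space is represented by the identity, N by p |-> p(0). *)
Lemma baire_delta_functional : forall p x x' : baire, x = p -> x' = p -> x = x'.
Proof. intros p x x' -> ->. reflexivity. Qed.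

Definition baire_space : rep_space :=
  RepSpace baire (PartialFun baire baire (fun p x => x = p) baire_delta_functional)
    (fun x => ex_intro _ x eq_refl).

Lemma nat_delta_functional :
  forall (p : baire) (n n' : nat), n = p 0 -> n' = p 0 -> n = n'.
Proof. intros p n n' -> ->. reflexivity. Qed.

Definition nat_space : rep_space :=
  RepSpace nat (PartialFun baire nat (fun p n => n = p 0) nat_delta_functional)
    (fun n => ex_intro _ (fun _ => n) eq_refl).

Definition G_map (phi : nat -> partial_fun nat nat) (p : baire) (i : nat) : Prop :=
  forall n, phi i n (p n).

Definition K_map (phi : nat -> partial_fun nat nat) (p : baire) (i : nat) : Prop :=
  G_map phi p i /\ forall j, G_map phi p j -> i <= j.

Definition K_ge_map (phi : nat -> partial_fun nat nat) (p : baire) (m : nat) : Prop :=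
  exists k, K_map phi p k /\ k <= m.

Definition B_map (p : baire) (m : nat) : Prop := forall n, p n <= m.

Definition C_N_map (p : baire) (n : nat) : Prop := forall k, p k <> n.

Definition G_problem phi : problem := problem_of baire_space nat_space (G_map phi).
Definition K_problem phi : problem := problem_of baire_space nat_space (K_map phi).
Definition K_ge_problem phi : problem := problem_of baire_space nat_space (K_ge_map phi).
Definition B_problem : problem := problem_of baire_space nat_space B_map.
Definition C_N_problem : problem := problem_of baire_space nat_space C_N_map.

Lemma dom_G (phi : nat -> partial_fun nat nat) :
  acceptable phi -> forall p, dom (G_map phi) p <-> computable_seq p.
Proof.
  intros [[u Hu] Hsmn] p. split.
  - intros [i Hi].
    assert (Hc : exists d, forall xs, eval0 d xs i).
    { clear. induction i as [|i [d Hd]].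
      - exists Zero. intros xs. reflexivity.
      - exists (Comp Succ [d]). intros xs. exists [i].
        split; [split; [apply Hd|exact I]|reflexivity]. }
    destruct Hc as [d Hd].
    exists (Comp u [d; Proj 0]). intros n. exists [i; n]. split.
    + split; [apply Hd|]. split; [reflexivity|exact I].
    + apply (proj1 (Hu i n (p n))), Hi.
  - intros [c Hc].
    destruct (Hsmn (Comp c [Proj 1])) as [s [_ Hs]].
    exists (s 0). intros n. apply (proj2 (Hs 0 n (p n))).
    exists [n]. split; [|apply Hc]. split; [reflexivity|exact I].
Qed.

Lemma dom_K (phi : nat -> partial_fun nat nat) (p : baire) :
  dom (K_map phi) p <-> dom (G_map phi) p.
Proof.
  split; [intros [i [Hi _]]; exists i; exact Hi|].
  intros [i Hi]. revert Hi. induction i as [i IH] using lt_wf_ind. intros Hi.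
  destruct (classic (exists j, j < i /\ G_map phi p j)) as [[j [Hj Hg]]|Hn].
  - exact (IH j Hj Hg).
  - exists i. split; [exact Hi|]. intros j Hg.
    destruct (Nat.le_gt_cases i j) as [H|H]; [exact H|].
    exfalso. apply Hn. exists j. auto.
Qed.

Lemma dom_K_ge (phi : nat -> partial_fun nat nat) (p : baire) :
  dom (K_ge_map phi) p <-> dom (G_map phi) p.
Proof.
  rewrite <- dom_K. split.
  - intros [m [k [Hk _]]]. exists k. exact Hk.
  - intros [k Hk]. exists k, k. auto.
Qed.

(* Main.v *)
From Stdlib Require Import List Arith Lia Bool Cantor.
From Stdlib Require Import Classical ClassicalEpsilon FunctionalExtensionality.
Require Import Defs.
Import ListNotations.

(** Write h for the halting problem and kappa for the least index of p.

    Relative to h the value of a partial computable function at a point can be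
    read off, so the least index that agrees with p below n is computable from
    p and n. These guesses never exceed kappa and stabilize at kappa
    ([guess_stabilizes]). The same happens for closed choice, where the guess is
    the least number not yet enumerated, and this drives most of the
    equivalences. The guesses form a bounded sequence all of whose bounds are at
    least kappa ([K_ge_le_B]). They are an eventually constant, hence
    computable, sequence, and from any index of it h finds a place after which
    nothing changes, so it finds the limit ([limit_spec], [sW_le_by_limit]):
    this reduces G, K and closed choice to both G and K. And a limit with
    finitely many changes is found by closed choice, by enumerating the pairs
    of a value and a time that a later guess contradicts ([sW_le_C_N]).

    For B below the bound version of K, a bounded p is turned into a sequence
    that vanishes except where p reaches a new record; there it exceeds all
    values of programs with index at most that record. It is computable because
    it is eventually zero, and every index of it exceeds every value of p
    ([escaping_index]).

    The remaining reduction turns a bound m on kappa into an index of p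
    ([G_le_K_ge]). With h one searches for a way to discard some of the indices
    0, ..., m, each discarded one together with a point where it visibly differs
    from p, such that the indices that are kept never contradict each other.
    Absence of contradiction is a co-enumerable condition, hence one question
    to h, and discarding everything that differs from p somewhere satisfies it.
    As kappa can never be discarded, running all kept indices in parallel and
    returning the first answer computes p, and the s-m-n property gives an
    index of this program.

    Parallel runs need a step counter. For a fixed code it is defined by
    structural recursion, and Kleene's normal form theorem ([steps_sound],
    [steps_complete], [recursive_steps]) is proved without any encoding of
    programs as numbers. Programs are never written down: being recursive is a
    property of functions of an environment that is closed under the
    usual operations, and explicit codes are confined to a few basic lemmas. *)

(** * Recursive expressions in a context *)

(** An environment [e : E] determines an oracle and the list of arguments on
    which a code is run. A type of environments, rather than a number of
    arguments, lets one code serve a whole class of oracles, and lets side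
    conditions on the inputs be part of [E]. *)
Record context (E : Type) : Type := Context {
  oracle : E -> baire;
  vars : list (E -> nat)
}.
Arguments Context {E}.
Arguments oracle {E}.
Arguments vars {E}.

(** The context under one more binder. The newest variable comes first, as in
    the argument lists that [Prec] and [Mu] pass to their bodies. *)
Definition extend {E : Type} (G : context E) : context (E * nat) :=
  Context (fun e => oracle G (fst e))
    (snd :: map (fun v e => v (fst e)) (vars G)).

Definition arguments {E : Type} (G : context E) (e : E) : list nat :=
  map (fun v => v e) (vars G).

(** The code does not depend on the environment, so the computation is uniform
    in the oracle and in the arguments. *)
Definition recursive {E : Type} (G : context E) (f : E -> nat) : Prop :=
  exists c, forall e, eval (oracle G e) c (arguments G e) (f e).

Definition decidable {E : Type} (G : context E) (b : E -> bool) : Prop :=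
  recursive G (fun e => Nat.b2n (b e)).

Definition sequence {E : Type} (G : context E) (a : E -> baire) : Prop :=
  recursive (extend G) (fun e => a (fst e) (snd e)).

Lemma recursive_ext {E} (G : context E) (f g : E -> nat) :
  (forall e, f e = g e) -> recursive G f -> recursive G g.
Proof.
  intros H [c Hc]. exists c. intros e. rewrite <- H. apply Hc.
Qed.

Lemma arguments_extend {E} (G : context E) (e : E) (x : nat) :
  arguments (extend G) (e, x) = x :: arguments G e.
Proof. unfold arguments; simpl. rewrite map_map. reflexivity. Qed.

Lemma recursive_all {E} (G : context E) (gs : list (E -> nat)) :
  Forall (recursive G) gs ->
  exists cs, forall e,
    all2 (fun c z => eval (oracle G e) c (arguments G e) z) cs
      (map (fun g => g e) gs).
Proof.
  induction 1 as [|g gs [c Hc] _ [cs Hcs]].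
  - exists []. intros e. exact I.
  - exists (c :: cs). intros e. split; [apply Hc|apply Hcs].
Qed.

Definition substitution {E F : Type} (D : context F) (G : context E) (m : F -> E) : Prop :=
  (forall e, oracle G (m e) = oracle D e) /\
  Forall (fun v => recursive D (fun e => v (m e))) (vars G).

Lemma recursive_subst {E F} (D : context F) (G : context E) (m : F -> E) (f : E -> nat) :
  substitution D G m -> recursive G f -> recursive D (fun e => f (m e)).
Proof.
  intros [Ho Hv] [c Hc].
  destruct (recursive_all D (map (fun v e => v (m e)) (vars G))) as [cs Hcs].
  { apply Forall_map. exact Hv. }
  exists (Comp c cs). intros e. exists (arguments G (m e)). split.
  - specialize (Hcs e). rewrite map_map in Hcs. exact Hcs.
  - rewrite <- Ho. apply Hc.
Qed.

Lemma recursive_nth {E} (G : context E) (i : nat) (v : E -> nat) :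
  nth_error (vars G) i = Some v -> recursive G v.
Proof.
  intros H. exists (Proj i). intros e. simpl. unfold arguments.
  rewrite nth_error_map, H. reflexivity.
Qed.

Lemma recursive_here {E} (G : context E) : recursive (extend G) (fun e => snd e).
Proof. exact (recursive_nth (extend G) 0 _ eq_refl). Qed.

Lemma recursive_var {E} (G : context E) (v : E -> nat) : In v (vars G) -> recursive G v.
Proof.
  intros H. destruct (In_nth_error _ _ H) as [i Hi]. exact (recursive_nth G i v Hi).
Qed.

Lemma recursive_weaken {E} (G : context E) (f : E -> nat) :
  recursive G f -> recursive (extend G) (fun e => f (fst e)).
Proof.
  apply recursive_subst. split; [reflexivity|].
  apply Forall_forall. intros v Hv. apply recursive_var. right.
  apply (in_map (fun v e => v (fst e))). exact Hv.
Qed.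

Lemma substitution_id {E} (G : context E) : substitution G G (fun e => e).
Proof. split; [reflexivity|]. apply Forall_forall. apply recursive_var. Qed.

Lemma substitution_weaken {E F} (D : context F) (G : context E) (m : F -> E) :
  substitution D G m -> substitution (extend D) G (fun e => m (fst e)).
Proof.
  intros [Ho Hv]. split; [intros e; apply Ho|]. revert Hv. apply Forall_impl.
  intros v. apply (recursive_weaken D (fun e => v (m e))).
Qed.

Lemma substitution_extend {E F} (D : context F) (G : context E) (m : F -> E)
    (f : F -> nat) :
  substitution D G m -> recursive D f -> substitution D (extend G) (fun e => (m e, f e)).
Proof.
  intros [Ho Hv] Hf. split; [exact Ho|]. constructor; [exact Hf|].
  apply Forall_map. exact Hv.
Qed.

Lemma decidable_weaken {E} (G : context E) (b : E -> bool) :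
  decidable G b -> decidable (extend G) (fun e => b (fst e)).
Proof. exact (recursive_weaken G (fun e => Nat.b2n (b e))). Qed.

Lemma recursive_seq {E} (G : context E) (a : E -> baire) (f : E -> nat) :
  sequence G a -> recursive G f -> recursive G (fun e => a e (f e)).
Proof.
  intros Ha Hf.
  exact (recursive_subst _ _ _ _ (substitution_extend _ _ _ f (substitution_id G) Hf) Ha).
Qed.

Lemma sequence_weaken {E} (G : context E) (a : E -> baire) :
  sequence G a -> sequence (extend G) (fun e => a (fst e)).
Proof.
  apply (recursive_subst _ _ (fun e => (fst (fst e), snd e))
           (fun e => a (fst e) (snd e))).
  apply (substitution_extend _ G (fun e => fst (fst e)) snd); [|apply recursive_here].
  exact (substitution_weaken _ _ _ (substitution_weaken _ _ _ (substitution_id G))).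
Qed.

Lemma sequence_oracle {E} (G : context E) : sequence G (oracle G).
Proof.
  exists (Comp Oracle [Proj 0]). intros [e x]. exists [x].
  split; [split; [reflexivity|exact I]|reflexivity].
Qed.

Lemma recursive_succ {E} (G : context E) (f : E -> nat) :
  recursive G f -> recursive G (fun e => S (f e)).
Proof.
  intros [c Hc]. exists (Comp Succ [c]). intros e. exists [f e].
  split; [split; [apply Hc|exact I]|reflexivity].
Qed.

Lemma recursive_const {E} (G : context E) (n : nat) : recursive G (fun _ => n).
Proof.
  induction n as [|n IH].
  - exists Zero. reflexivity.
  - apply recursive_succ. exact IH.
Qed.

(** [Prec] calls its body with the counter before the previous value, so the
    counter is the innermost of the two new variables. *)
Lemma recursive_rec {E} (G : context E) (f n : E -> nat) (g : E -> nat -> nat -> nat) :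
  recursive G f ->
  recursive (extend (extend G)) (fun e => g (fst (fst e)) (snd e) (snd (fst e))) ->
  recursive G n ->
  recursive G (fun e => nat_rect (fun _ => nat) (f e) (g e) (n e)).
Proof.
  intros [cf Hf] [cg Hg] Hn.
  assert (H : sequence G (fun e => nat_rect (fun _ => nat) (f e) (g e))).
  { exists (Prec cf cg). intros [e k]. rewrite arguments_extend. simpl.
    induction k as [|k IH]; [apply Hf|].
    exists (nat_rect (fun _ => nat) (f e) (g e) k). split; [exact IH|].
    specialize (Hg (e, nat_rect (fun _ => nat) (f e) (g e) k, k)).
    rewrite !arguments_extend in Hg. exact Hg. }
  exact (recursive_seq G _ n H Hn).
Qed.

(** * Arithmetic and decidable conditions *)

(** Undoes one [extend]: the newest variable is replaced by 0, and a goal that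
    depends on it is then rejected by conversion. *)
Ltac weaken :=
  lazymatch goal with
  | |- recursive (extend ?G) ?f =>
      let g := eval cbn beta iota delta [fst snd] in (fun x => f (x, 0)) in
      refine (recursive_weaken G g _)
  | |- decidable (extend ?G) ?b =>
      let c := eval cbn beta iota delta [fst snd] in (fun x => b (x, 0)) in
      refine (decidable_weaken G c _)
  | |- sequence (extend ?G) ?a =>
      let a' := eval cbn beta iota delta [fst snd] in (fun x => a (x, 0)) in
      refine (sequence_weaken G a' _)
  end.

Lemma recursive_pred {E} (G : context E) (f : E -> nat) :
  recursive G f -> recursive G (fun e => Nat.pred (f e)).
Proof.
  intros Hf.
  apply (recursive_ext _ (fun e => nat_rect (fun _ => nat) 0 (fun m _ => m) (f e))).
  - intros e. destruct (f e); reflexivity.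
  - apply (recursive_rec G (fun _ => 0) f (fun _ m _ => m));
      [apply recursive_const|apply recursive_here|exact Hf].
Qed.

Lemma recursive_add {E} (G : context E) (f g : E -> nat) :
  recursive G f -> recursive G g -> recursive G (fun e => f e + g e).
Proof.
  intros Hf Hg.
  apply (recursive_ext _ (fun e => nat_rect (fun _ => nat) (g e) (fun _ r => S r) (f e))).
  - intros e. induction (f e) as [|n IH]; simpl; congruence.
  - apply (recursive_rec G g f (fun _ _ r => S r)); [exact Hg| |exact Hf].
    apply recursive_succ. weaken. apply recursive_here.
Qed.

Lemma recursive_sub {E} (G : context E) (f g : E -> nat) :
  recursive G f -> recursive G g -> recursive G (fun e => f e - g e).
Proof.
  intros Hf Hg.
  apply (recursive_ext _
           (fun e => nat_rect (fun _ => nat) (f e) (fun _ r => Nat.pred r) (g e))).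
  - intros e. induction (g e) as [|n IH]; simpl; [lia|rewrite IH; lia].
  - apply (recursive_rec G f g (fun _ _ r => Nat.pred r)); [exact Hf| |exact Hg].
    apply recursive_pred. weaken. apply recursive_here.
Qed.

Lemma recursive_if {E} (G : context E) (b : E -> bool) (f g : E -> nat) :
  decidable G b -> recursive G f -> recursive G g ->
  recursive G (fun e => if b e then f e else g e).
Proof.
  intros Hb Hf Hg.
  apply (recursive_ext _
           (fun e => nat_rect (fun _ => nat) (g e) (fun _ _ => f e) (Nat.b2n (b e)))).
  - intros e. destruct (b e); reflexivity.
  - apply (recursive_rec G g _ (fun e _ _ => f e)); [exact Hg| |exact Hb].
    weaken. weaken. exact Hf.
Qed.

Lemma decidable_ext {E} (G : context E) (b c : E -> bool) :
  (forall e, b e = c e) -> decidable G b -> decidable G c.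
Proof. intros H. apply recursive_ext. intros e. f_equal. apply H. Qed.

Lemma decidable_if {E} (G : context E) (b c d : E -> bool) :
  decidable G b -> decidable G c -> decidable G d ->
  decidable G (fun e => if b e then c e else d e).
Proof.
  intros Hb Hc Hd.
  apply (recursive_ext _ (fun e => if b e then Nat.b2n (c e) else Nat.b2n (d e))).
  - intros e. destruct (b e); reflexivity.
  - apply recursive_if; assumption.
Qed.

Lemma decidable_const {E} (G : context E) (b : bool) : decidable G (fun _ => b).
Proof. exact (recursive_const G (Nat.b2n b)). Qed.

Lemma decidable_negb {E} (G : context E) (b : E -> bool) :
  decidable G b -> decidable G (fun e => negb (b e)).
Proof. intros Hb. apply decidable_if; [exact Hb|apply decidable_const..]. Qed.

Lemma decidable_andb {E} (G : context E) (b c : E -> bool) :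
  decidable G b -> decidable G c -> decidable G (fun e => b e && c e).
Proof. intros Hb Hc. apply decidable_if; [exact Hb|exact Hc|apply decidable_const]. Qed.

Lemma decidable_orb {E} (G : context E) (b c : E -> bool) :
  decidable G b -> decidable G c -> decidable G (fun e => b e || c e).
Proof. intros Hb Hc. apply decidable_if; [exact Hb|apply decidable_const|exact Hc]. Qed.

Lemma decidable_leb {E} (G : context E) (f g : E -> nat) :
  recursive G f -> recursive G g -> decidable G (fun e => f e <=? g e).
Proof.
  intros Hf Hg.
  apply (recursive_ext _ (fun e => 1 - (f e - g e))).
  - intros e. destruct (Nat.leb_spec (f e) (g e)); simpl Nat.b2n; lia.
  - apply recursive_sub; [apply recursive_const|]. apply recursive_sub; assumption.
Qed.

Lemma decidable_ltb {E} (G : context E) (f g : E -> nat) :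
  recursive G f -> recursive G g -> decidable G (fun e => f e <? g e).
Proof. intros Hf Hg. apply decidable_leb; [apply recursive_succ|]; assumption. Qed.

Lemma decidable_eqb {E} (G : context E) (f g : E -> nat) :
  recursive G f -> recursive G g -> decidable G (fun e => f e =? g e).
Proof.
  intros Hf Hg.
  apply (decidable_ext _ (fun e => (f e <=? g e) && (g e <=? f e))).
  - intros e. apply eq_true_iff_eq.
    rewrite andb_true_iff, !Nat.leb_le, Nat.eqb_eq. lia.
  - apply decidable_andb; apply decidable_leb; assumption.
Qed.

(** * Unbounded search *)

Definition is_least (b : nat -> bool) (n : nat) : Prop :=
  b n = true /\ forall k, k < n -> b k = false.

Definition least (b : nat -> bool) : nat := epsilon (inhabits 0) (is_least b).

Lemma least_spec (b : nat -> bool) : (exists n, b n = true) -> is_least b (least b).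
Proof.
  intros [n Hn]. unfold least. apply epsilon_spec.
  induction n as [n IH] using lt_wf_ind.
  destruct (excluded_middle_informative (exists k, k < n /\ b k = true))
    as [[k [Hk Hb]]|H].
  - exact (IH k Hk Hb).
  - exists n. split; [exact Hn|]. intros k Hk.
    destruct (b k) eqn:Hb; [|reflexivity]. exfalso. eauto.
Qed.

Lemma least_eq (b : nat -> bool) (n : nat) :
  b n = true -> (forall k, k < n -> b k = false) -> least b = n.
Proof.
  intros Hn Hlt. destruct (least_spec b (ex_intro _ n Hn)) as [H1 H2].
  destruct (Nat.lt_total (least b) n) as [H|[H|H]]; [|exact H|].
  - rewrite (Hlt _ H) in H1. discriminate.
  - rewrite (H2 _ H) in Hn. discriminate.
Qed.

Lemma recursive_least {E} (G : context E) (b : E -> nat -> bool) :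
  (forall e, exists n, b e n = true) ->
  decidable (extend G) (fun e => b (fst e) (snd e)) ->
  recursive G (fun e => least (b e)).
Proof.
  intros Hex Hb. destruct (decidable_negb _ _ Hb) as [c Hc].
  exists (Mu c). intros e.
  assert (Hk : forall k, eval (oracle G e) c (k :: arguments G e) (Nat.b2n (negb (b e k)))).
  { intros k. rewrite <- arguments_extend. apply (Hc (e, k)). }
  destruct (least_spec (b e) (Hex e)) as [H1 H2]. split.
  - specialize (Hk (least (b e))). rewrite H1 in Hk. exact Hk.
  - intros k Hlt. exists 0. specialize (Hk k). rewrite (H2 k Hlt) in Hk. exact Hk.
Qed.

(** A bounded quantifier as a search that stops at [n] at the latest, so that
    it inherits its recursiveness from [recursive_least]. *)
Definition all_below (n : nat) (b : nat -> bool) : bool :=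
  n <=? least (fun k => (n <=? k) || negb (b k)).

Lemma all_below_spec (n : nat) (b : nat -> bool) :
  all_below n b = true <-> forall k, k < n -> b k = true.
Proof.
  unfold all_below.
  destruct (least_spec (fun k => (n <=? k) || negb (b k))) as [H1 H2].
  { exists n. rewrite Nat.leb_refl. reflexivity. }
  set (m := least _) in *. rewrite Nat.leb_le. split.
  - intros Hm k Hk. specialize (H2 k ltac:(lia)).
    apply orb_false_iff in H2. apply negb_false_iff. tauto.
  - intros Hb. apply Nat.nlt_ge. intros Hlt.
    rewrite (Hb m Hlt), orb_false_r in H1. apply Nat.leb_le in H1. lia.
Qed.

Lemma decidable_all_below {E} (G : context E) (n : E -> nat) (b : E -> nat -> bool) :
  recursive G n -> decidable (extend G) (fun e => b (fst e) (snd e)) ->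
  decidable G (fun e => all_below (n e) (b e)).
Proof.
  intros Hn Hb. apply decidable_leb; [exact Hn|].
  apply (recursive_least G (fun e k => (n e <=? k) || negb (b e k))).
  - intros e. exists (n e). rewrite Nat.leb_refl. reflexivity.
  - apply decidable_orb; [|apply decidable_negb; exact Hb].
    apply decidable_leb; [|apply recursive_here]. weaken. exact Hn.
Qed.

(** * Pairs and finite sequences *)

Definition pairing (x y : nat) : nat := to_nat (x, y).
Definition left (z : nat) : nat := fst (of_nat z).
Definition right (z : nat) : nat := snd (of_nat z).

Lemma left_pairing (x y : nat) : left (pairing x y) = x.
Proof. unfold left, pairing. rewrite cancel_of_to. reflexivity. Qed.

Lemma right_pairing (x y : nat) : right (pairing x y) = y.
Proof. unfold right, pairing. rewrite cancel_of_to. reflexivity. Qed.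

Lemma pairing_left_right (z : nat) : pairing (left z) (right z) = z.
Proof.
  unfold pairing, left, right. rewrite <- surjective_pairing. apply cancel_to_of.
Qed.

Lemma pairing_ge (x y : nat) : x <= pairing x y /\ y <= pairing x y.
Proof. unfold pairing. pose proof (to_nat_non_decreasing x y). lia. Qed.

Lemma recursive_pairing {E} (G : context E) (f g : E -> nat) :
  recursive G f -> recursive G g -> recursive G (fun e => pairing (f e) (g e)).
Proof.
  intros Hf Hg.
  apply recursive_add; [exact Hg|].
  apply (recursive_rec G (fun _ => 0) (fun e => g e + f e) (fun _ i m => S i + m));
    [apply recursive_const| |apply recursive_add; assumption].
  apply recursive_add; [apply recursive_succ, recursive_here|].
  weaken. apply recursive_here.
Qed.

Lemma recursive_left {E} (G : context E) (f : E -> nat) :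
  recursive G f -> recursive G (fun e => left (f e)).
Proof.
  intros Hf.
  set (b := fun z x => negb (all_below (S z) (fun y => negb (pairing x y =? z)))).
  assert (Hb : forall z x, b z x = true <-> x = left z).
  { intros z x. unfold b. rewrite negb_true_iff, <- not_true_iff_false, all_below_spec.
    split.
    - intros H. apply NNPP. intros Hne. apply H. intros y _.
      apply negb_true_iff, Nat.eqb_neq. intros <-. apply Hne. symmetry. apply left_pairing.
    - intros -> H. specialize (H (right z)). rewrite pairing_left_right, Nat.eqb_refl in H.
      pose proof (pairing_ge (left z) (right z)) as Hle. rewrite pairing_left_right in Hle.
      discriminate H. lia. }
  apply (recursive_ext _ (fun e => least (b (f e)))).
  - intros e. apply Hb, least_spec. exists (left (f e)). apply Hb. reflexivity.
  - apply (recursive_least G (fun e => b (f e))).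
    + intros e. exists (left (f e)). apply Hb. reflexivity.
    + apply decidable_negb.
      apply (decidable_all_below _ (fun e => S (f (fst e)))
               (fun e y => negb (pairing (snd e) y =? f (fst e)))).
      * apply recursive_succ. weaken. exact Hf.
      * apply decidable_negb, decidable_eqb.
        -- apply recursive_pairing; [weaken|]; apply recursive_here.
        -- weaken. weaken. exact Hf.
Qed.

Lemma recursive_right {E} (G : context E) (f : E -> nat) :
  recursive G f -> recursive G (fun e => right (f e)).
Proof.
  intros Hf.
  assert (Hz : forall z, pairing (left z) (right z) =? z = true).
  { intros z. apply Nat.eqb_eq, pairing_left_right. }
  apply (recursive_ext _ (fun e => least (fun y => pairing (left (f e)) y =? f e))).
  - intros e. destruct (least_spec (fun y => pairing (left (f e)) y =? f e)
                          (ex_intro _ _ (Hz (f e)))) as [H _].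
    apply Nat.eqb_eq in H. rewrite <- (right_pairing (left (f e)) (least _)), H.
    reflexivity.
  - apply (recursive_least G (fun e y => pairing (left (f e)) y =? f e)).
    + intros e. exists (right (f e)). apply Hz.
    + apply decidable_eqb; [apply recursive_pairing; [|apply recursive_here]|]; weaken.
      * apply recursive_left. exact Hf.
      * exact Hf.
Qed.

(** A number codes an infinite sequence by iterated unpairing, and every finite
    sequence is a prefix of one of these ([entry_choice]). *)
Definition entry (a i : nat) : nat :=
  left (nat_rect (fun _ => nat) a (fun _ r => right r) i).

Lemma recursive_entry {E} (G : context E) (a i : E -> nat) :
  recursive G a -> recursive G i -> recursive G (fun e => entry (a e) (i e)).
Proof.
  intros Ha Hi. apply recursive_left.
  apply (recursive_rec G a i (fun _ _ r => right r)); [exact Ha| |exact Hi].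
  apply recursive_right. weaken. apply recursive_here.
Qed.

Lemma entry_zero (x a : nat) : entry (pairing x a) 0 = x.
Proof. apply left_pairing. Qed.

Lemma entry_succ (x a i : nat) : entry (pairing x a) (S i) = entry a i.
Proof.
  unfold entry. f_equal.
  induction i as [|i IH]; [apply right_pairing|]. simpl in *. congruence.
Qed.

Lemma entry_choice (n : nat) (P : nat -> nat -> Prop) :
  (forall i, i < n -> exists x, P i x) -> exists a, forall i, i < n -> P i (entry a i).
Proof.
  revert P. induction n as [|n IH]; intros P H.
  - exists 0. intros i Hi. lia.
  - destruct (IH (fun i => P (S i))) as [a Ha]; [intros i Hi; apply H; lia|].
    destruct (H 0) as [x Hx]; [lia|]. exists (pairing x a). intros [|i] Hi.
    + rewrite entry_zero. exact Hx.
    + rewrite entry_succ. apply Ha. lia.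
Qed.

(** Reduces a recursiveness goal to its atoms by following the syntax of the
    expression. Totality of searches is left to the user. The rules for
    simulated programs are supplied once these have been treated. *)
Ltac solve_simulated := fail.

Ltac solve_recursive :=
  cbn beta;
  first [solve_simulated | solve_basic]
with solve_basic :=
  lazymatch goal with
  | |- decidable _ (fun _ => ?b) => apply decidable_const
  | |- decidable ?G (fun e => negb (@?b e)) => apply (decidable_negb G b); solve_recursive
  | |- decidable ?G (fun e => @?b e && @?c e) =>
      apply (decidable_andb G b c); solve_recursive
  | |- decidable ?G (fun e => @?b e || @?c e) =>
      apply (decidable_orb G b c); solve_recursive
  | |- decidable ?G (fun e => @?f e <? @?g e) =>
      apply (decidable_ltb G f g); solve_recursive
  | |- decidable ?G (fun e => @?f e <=? @?g e) =>
      apply (decidable_leb G f g); solve_recursive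
  | |- decidable ?G (fun e => @?f e =? @?g e) =>
      apply (decidable_eqb G f g); solve_recursive
  | |- decidable ?G (fun e => all_below (@?n e) (@?b e)) =>
      apply (decidable_all_below G n b); solve_recursive
  | |- recursive _ (fun _ => ?n) => apply recursive_const
  | |- recursive ?G (fun e => S (@?f e)) => apply (recursive_succ G f); solve_recursive
  | |- recursive ?G (fun e => Nat.pred (@?f e)) =>
      apply (recursive_pred G f); solve_recursive
  | |- recursive ?G (fun e => @?f e + @?g e) =>
      apply (recursive_add G f g); solve_recursive
  | |- recursive ?G (fun e => @?f e - @?g e) =>
      apply (recursive_sub G f g); solve_recursive
  | |- recursive ?G (fun e => pairing (@?f e) (@?g e)) =>
      apply (recursive_pairing G f g); solve_recursive
  | |- recursive ?G (fun e => entry (@?a e) (@?i e)) =>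
      apply (recursive_entry G a i); solve_recursive
  | |- recursive ?G (fun e => left (@?f e)) => apply (recursive_left G f); solve_recursive
  | |- recursive ?G (fun e => right (@?f e)) => apply (recursive_right G f); solve_recursive
  | |- recursive ?G (fun e => if @?b e then @?f e else @?g e) =>
      apply (recursive_if G b f g); solve_recursive
  | |- recursive ?G (fun e => least (@?b e)) =>
      apply (recursive_least G b); [|solve_recursive]
  | |- recursive ?G (fun e => nat_rect _ (@?f e) (@?g e) (@?n e)) =>
      apply (recursive_rec G f n g); solve_recursive
  | |- recursive (extend ?G) (fun e => snd e) => apply recursive_here
  | |- recursive (extend ?G) snd => apply recursive_here
  | |- _ => first [assumption | solve_application | weaken; solve_recursive | idtac]
  end
with solve_application :=
  match goal with
  | Hp : sequence _ ?p |- recursive ?G (fun e => ?p (@?x e) (@?n e)) =>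
      apply (recursive_seq G (fun e => p (x e)) n); solve_recursive
  end.

(** * Kleene's normal form *)

Lemma code_nested_ind (P : code -> Prop) :
  P Zero -> P Succ -> (forall i, P (Proj i)) -> P Oracle ->
  (forall f gs, P f -> Forall P gs -> P (Comp f gs)) ->
  (forall f g, P f -> P g -> P (Prec f g)) ->
  (forall f, P f -> P (Mu f)) ->
  forall c, P c.
Proof.
  intros HZ HS HP HO HC HR HM. fix IH 1. intros [| |i| |f gs|f g|f].
  - exact HZ.
  - exact HS.
  - apply HP.
  - exact HO.
  - apply HC; [apply IH|]. induction gs as [|g gs IHgs]; constructor; [apply IH|exact IHgs].
  - apply HR; apply IH.
  - apply HM; apply IH.
Qed.

(** The result of a run with bound [s] on all searches: [S y] for the value
    [y], and [0] if the bound is too small or the value undefined. The oracle is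
    the zero sequence. *)
Fixpoint steps (c : code) (s : nat) (xs : list nat) : nat :=
  match c with
  | Zero => 1
  | Succ => match xs with x :: _ => S (S x) | [] => 0 end
  | Proj i => match nth_error xs i with Some y => S y | None => 0 end
  | Oracle => match xs with _ :: _ => 1 | [] => 0 end
  | Comp f gs =>
      let ys := map (fun g => steps g s xs) gs in
      if forallb (fun y => 0 <? y) ys then steps f s (map Nat.pred ys) else 0
  | Prec f g =>
      match xs with
      | [] => 0
      | n :: xs' =>
          nat_rect (fun _ => nat) (steps f s xs')
            (fun m r => if 0 <? r then steps g s (m :: Nat.pred r :: xs') else 0) n
      end
  | Mu f =>
      (* stops at a zero of [f], at an unknown value of [f], or at [s] *)
      let y := least (fun y => (s <=? y) || (steps f s (y :: xs) <=? 1)) in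
      if steps f s (y :: xs) =? 1 then S y else 0
  end.

Lemma steps_sound (c : code) :
  forall s xs y, steps c s xs = S y -> eval0 c xs y.
Proof.
  unfold eval0.
  induction c as [| |i| |f gs IHf IHgs|f g IHf IHg|f IHf] using code_nested_ind;
    intros s xs y H; cbn [steps] in H.
  - injection H as <-. reflexivity.
  - destruct xs as [|x xs]; [discriminate|]. injection H as <-. reflexivity.
  - simpl. destruct (nth_error xs i); [|discriminate]. injection H as <-. reflexivity.
  - destruct xs as [|x xs]; [discriminate|]. injection H as <-. reflexivity.
  - cbv zeta in H. destruct (forallb _ _) eqn:Hall; [|discriminate].
    exists (map Nat.pred (map (fun g => steps g s xs) gs)).
    split; [|exact (IHf _ _ _ H)]. clear H.
    induction IHgs as [|g gs Hg _ IH]; [exact I|].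
    simpl in Hall. apply andb_true_iff in Hall. destruct Hall as [Hpos Hall].
    split; [|exact (IH Hall)]. apply (Hg s).
    apply Nat.ltb_lt in Hpos. lia.
  - destruct xs as [|n xs]; [discriminate|]. simpl.
    revert y H. induction n as [|n IH]; intros y H; [exact (IHf _ _ _ H)|].
    simpl in H. destruct (nat_rect _ _ _ n) as [|r]; [discriminate|].
    exists r. split; [apply IH; reflexivity|exact (IHg _ _ _ H)].
  - cbv zeta in H.
    destruct (least_spec (fun y => (s <=? y) || (steps f s (y :: xs) <=? 1))) as [_ Hlt].
    { exists s. rewrite Nat.leb_refl. reflexivity. }
    set (m := least _) in *.
    destruct (steps f s (m :: xs) =? 1) eqn:Hm; [|discriminate].
    injection H as <-. apply Nat.eqb_eq in Hm. split; [exact (IHf _ _ _ Hm)|].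
    intros k Hk. specialize (Hlt k Hk). apply orb_false_iff in Hlt.
    destruct Hlt as [_ Hlt]. apply Nat.leb_gt in Hlt.
    exists (steps f s (k :: xs) - 2). apply (IHf s). lia.
Qed.

Lemma bound_below (n : nat) (P : nat -> nat -> Prop) :
  (forall k, k < n -> exists s, forall t, s <= t -> P k t) ->
  exists s, forall k t, k < n -> s <= t -> P k t.
Proof.
  induction n as [|n IH]; intros H.
  - exists 0. intros k t Hk. lia.
  - destruct IH as [s Hs]; [intros k Hk; apply H; lia|].
    destruct (H n) as [s' Hs']; [lia|]. exists (s + s'). intros k t Hk Ht.
    destruct (Nat.eq_dec k n) as [->|]; [apply Hs'; lia|apply Hs; lia].
Qed.

(** Asserted for all large bounds and not just for one, so that finitely many
    runs can be given a common bound. *)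
Lemma steps_complete (c : code) :
  forall xs y, eval0 c xs y -> exists s, forall t, s <= t -> steps c t xs = S y.
Proof.
  unfold eval0.
  induction c as [| |i| |f gs IHf IHgs|f g IHf IHg|f IHf] using code_nested_ind;
    intros xs y H.
  - exists 0. intros t _. simpl in *. congruence.
  - destruct xs as [|x xs]; [destruct H|]. exists 0. intros t _. simpl in *. congruence.
  - exists 0. intros t _. simpl in *. rewrite H. reflexivity.
  - destruct xs as [|x xs]; [destruct H|]. exists 0. intros t _. simpl in *. congruence.
  - destruct H as [ys [Hgs Hf]]. destruct (IHf _ _ Hf) as [s Hs].
    assert (Hm : exists s', forall t, s' <= t -> map (fun g => steps g t xs) gs = map S ys).
    { clear Hf Hs. revert ys Hgs. induction IHgs as [|g gs Hg _ IH]; intros [|z ys] H;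
        try (destruct H; fail).
      - exists 0. reflexivity.
      - destruct H as [H1 H2]. destruct (Hg _ _ H1) as [a Ha].
        destruct (IH _ H2) as [b Hb]. exists (a + b). intros t Ht. simpl.
        rewrite Ha, Hb by lia. reflexivity. }
    destruct Hm as [s' Hs']. exists (s + s'). intros t Ht. cbn [steps]. cbv zeta.
    rewrite Hs' by lia. rewrite map_map, map_id.
    replace (forallb _ _) with true; [apply Hs; lia|].
    symmetry. apply forallb_forall. intros z Hz. apply in_map_iff in Hz.
    destruct Hz as [w [<- _]]. reflexivity.
  - destruct xs as [|n xs]; [destruct H|]. simpl in H. cbn [steps].
    revert y H. induction n as [|n IH]; intros y H; [exact (IHf _ _ H)|].
    destruct H as [r [Hr Hg]]. destruct (IH _ Hr) as [a Ha].
    destruct (IHg _ _ Hg) as [b Hb]. exists (a + b). intros t Ht. simpl.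
    rewrite Ha by lia. apply Hb. lia.
  - destruct H as [Hy Hlt]. destruct (IHf _ _ Hy) as [a Ha].
    destruct (bound_below y (fun k t => 1 < steps f t (k :: xs))) as [b Hb].
    { intros k Hk. destruct (Hlt k Hk) as [z Hz]. destruct (IHf _ _ Hz) as [s Hs].
      exists s. intros t Ht. rewrite Hs by exact Ht. lia. }
    exists (y + a + b). intros t Ht. cbn [steps]. cbv zeta.
    rewrite (least_eq _ y).
    + rewrite Ha by lia. reflexivity.
    + rewrite Ha by lia. apply orb_true_r.
    + intros k Hk. specialize (Hb k t Hk ltac:(lia)).
      apply orb_false_iff. split; apply Nat.leb_gt; lia.
Qed.

Lemma eval0_functional (c : code) (xs : list nat) (y z : nat) :
  eval0 c xs y -> eval0 c xs z -> y = z.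
Proof.
  intros Hy Hz. destruct (steps_complete _ _ _ Hy) as [a Ha].
  destruct (steps_complete _ _ _ Hz) as [b Hb].
  specialize (Ha (a + b) ltac:(lia)). specialize (Hb (a + b) ltac:(lia)). congruence.
Qed.

Lemma decidable_forallb_pos {E} (G : context E) (gs : list (E -> nat)) :
  Forall (recursive G) gs ->
  decidable G (fun e => forallb (fun y => 0 <? y) (map (fun g => g e) gs)).
Proof.
  induction 1 as [|g gs Hg _ IH]; simpl; [apply decidable_const|].
  solve_recursive.
Qed.

(** For a fixed code the step-bounded run is a finite composition of recursive
    operations. The induction runs over all contexts at once because primitive
    recursion and search extend them. *)
Lemma recursive_steps (c : code) :
  forall (E : Type) (G : context E) (s : E -> nat) (gs : list (E -> nat)),
    recursive G s -> Forall (recursive G) gs ->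
    recursive G (fun e => steps c (s e) (map (fun g => g e) gs)).
Proof.
  assert (Hlift : forall E (G : context E) gs, Forall (recursive G) gs ->
            Forall (recursive (extend G)) (map (fun g e => g (fst e)) gs)).
  { intros E G gs Hgs. apply Forall_map. revert Hgs. apply Forall_impl.
    intros g. apply recursive_weaken. }
  induction c as [| |i| |f hs IHf IHhs|f g IHf IHg|f IHf] using code_nested_ind;
    intros E G s gs Hs Hgs; cbn [steps].
  - apply recursive_const.
  - destruct Hgs as [|g gs Hg _]; simpl; [apply recursive_const|].
    solve_recursive.
  - apply (recursive_ext _ (match nth_error gs i with
                            | Some g => fun e => S (g e) | None => fun _ => 0 end)).
    + intros e. rewrite nth_error_map. destruct (nth_error gs i); reflexivity.
    + destruct (nth_error gs i) as [g|] eqn:Hg; [|apply recursive_const].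
      apply recursive_succ. rewrite Forall_forall in Hgs.
      exact (Hgs g (nth_error_In _ _ Hg)).
  - destruct Hgs; cbn [map]; apply recursive_const.
  - cbv zeta.
    pose (hs' := map (fun h e => steps h (s e) (map (fun g => g e) gs)) hs).
    assert (Hhs' : Forall (recursive G) hs').
    { apply Forall_map. revert IHhs. apply Forall_impl. intros h Hh. apply Hh; assumption. }
    apply (recursive_ext _ (fun e =>
      if forallb (fun y => 0 <? y) (map (fun h => h e) hs')
      then steps f (s e) (map (fun h => h e) (map (fun h e => Nat.pred (h e)) hs'))
      else 0)).
    + intros e. unfold hs'. rewrite !map_map. reflexivity.
    + apply recursive_if; [apply decidable_forallb_pos; exact Hhs'| |apply recursive_const].
      apply IHf; [exact Hs|]. apply Forall_map. revert Hhs'. apply Forall_impl.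
      intros h. apply recursive_pred.
  - destruct Hgs as [|n gs Hn Hgs]; cbn [map]; [apply recursive_const|].
    apply (recursive_rec G (fun e => steps f (s e) (map (fun g => g e) gs)) n
      (fun e m r => if 0 <? r
         then steps g (s e) (m :: Nat.pred r :: map (fun g => g e) gs) else 0)).
    + apply IHf; assumption.
    + solve_recursive.
      apply (recursive_ext _ (fun e => steps g (s (fst (fst e))) (map (fun h => h e)
        (snd :: (fun e => Nat.pred (snd (fst e)))
           :: map (fun g e => g (fst e)) (map (fun g e => g (fst e)) gs))))).
      * intros e. cbn [map]. rewrite !map_map. reflexivity.
      * apply IHg; [solve_recursive|].
        constructor; [solve_recursive|]. constructor; [solve_recursive|].
        apply Hlift, Hlift, Hgs.
    + exact Hn.
  - cbv zeta.
    assert (Hf : recursive (extend G) (fun e =>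
              steps f (s (fst e)) (snd e :: map (fun g => g (fst e)) gs))).
    { apply (recursive_ext _ (fun e => steps f (s (fst e)) (map (fun h => h e)
               (snd :: map (fun g e => g (fst e)) gs)))).
      - intros e. cbn [map]. rewrite map_map. reflexivity.
      - apply IHf; [solve_recursive|]. constructor; [solve_recursive|apply Hlift, Hgs]. }
    pose (y := fun e => least (fun y => (s e <=? y)
                 || (steps f (s e) (y :: map (fun g => g e) gs) <=? 1))).
    assert (Hy : recursive G y).
    { apply (recursive_least G (fun e y => (s e <=? y)
                 || (steps f (s e) (y :: map (fun g => g e) gs) <=? 1))).
      - intros e. exists (s e). rewrite Nat.leb_refl. reflexivity.
      - solve_recursive. }
    pose proof (recursive_seq G (fun e y => steps f (s e) (y :: map (fun g => g e) gs))
                  y Hf Hy) as Hfy.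
    change (recursive G (fun e =>
      if steps f (s e) (y e :: map (fun g => g e) gs) =? 1 then S (y e) else 0)).
    solve_recursive.
Qed.

(** * Questions to the halting problem *)

Definition empty_context : context unit := Context (fun _ _ => 0) [].

(** A code for [s] presupposes the zero oracle and may behave differently with
    the oracle of [G]; its simulation by [steps] does not query the oracle. *)
Lemma recursive_computable_seq {E} (G : context E) (s : baire) (f : E -> nat) :
  computable_seq s -> recursive G f -> recursive G (fun e => s (f e)).
Proof.
  intros [c Hc] Hf.
  assert (Hs : forall n, exists t, steps c t [n] =? S (s n) = true).
  { intros n. destruct (steps_complete c [n] (s n) (Hc n)) as [t Ht]. exists t.
    apply Nat.eqb_eq, Ht. lia. }
  assert (Hex : forall n, exists t, 0 <? steps c t [n] = true).
  { intros n. destruct (Hs n) as [t Ht]. exists t. apply Nat.eqb_eq in Ht.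
    rewrite Ht. reflexivity. }
  apply (recursive_ext _ (fun e => Nat.pred (steps c
           (least (fun t => 0 <? steps c t [f e])) [f e]))).
  - intros e. destruct (least_spec _ (Hex (f e))) as [H _].
    set (t := least _) in *. apply Nat.ltb_lt in H.
    destruct (steps c t [f e]) as [|m] eqn:Hm; [lia|].
    apply steps_sound in Hm. exact (eval0_functional _ _ _ _ Hm (Hc (f e))).
  - apply recursive_pred.
    apply (recursive_steps c _ G (fun e => least (fun t => 0 <? steps c t [f e])) [f]);
      [|constructor; [exact Hf|constructor]].
    solve_recursive; [intros e; apply Hex|].
    apply (recursive_steps c _ (extend G) snd [fun e => f (fst e)]);
      [|constructor; [|constructor]]; solve_recursive.
Qed.

(** A program with parameter [z] that searches on input [n] for a witness [t]
    and outputs a value computed from the least one. *)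
Lemma parametrized_search (phi : nat -> partial_fun nat nat)
    (b : nat -> nat -> nat -> bool) (v : nat -> nat -> nat -> nat) :
  acceptable phi ->
  decidable (extend (extend (extend empty_context)))
    (fun e => b (snd (fst e)) (snd (fst (fst e))) (snd e)) ->
  recursive (extend (extend (extend empty_context)))
    (fun e => v (snd (fst e)) (snd (fst (fst e))) (snd e)) ->
  exists s, computable_seq s /\
    (forall z n, (exists t, b z n t = true) -> phi (s z) n (v z n (least (b z n)))) /\
    (forall z n m, phi (s z) n m -> exists t, b z n t = true).
Proof.
  intros Hphi Hb [cv Hcv]. destruct (decidable_negb _ _ Hb) as [cb Hcb].
  assert (Hb0 : forall z n t, eval0 cb [t; z; n] (Nat.b2n (negb (b z n t)))).
  { intros z n t. exact (Hcb (tt, n, z, t)). }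
  destruct (acceptable_smn phi Hphi (Comp cv [Mu cb; Proj 0; Proj 1])) as [s [Hs Hsmn]].
  exists s. split; [exact Hs|]. split.
  - intros z n Hex. apply Hsmn. exists [least (b z n); z; n].
    destruct (least_spec (b z n) Hex) as [H1 H2].
    split; [split; [split|]|exact (Hcv (tt, n, z, least (b z n)))].
    + pose proof (Hb0 z n (least (b z n))) as H. rewrite H1 in H. exact H.
    + intros k Hk. exists 0. pose proof (Hb0 z n k) as H. rewrite (H2 k Hk) in H. exact H.
    + repeat split.
  - intros z n m Hm. apply Hsmn in Hm. destruct Hm as [ys [Hys _]].
    destruct ys as [|t ys]; [destruct Hys|]. destruct Hys as [[Ht _] _].
    exists t. pose proof (eval0_functional _ _ _ _ Ht (Hb0 z n t)) as H.
    destruct (b z n t); [reflexivity|discriminate].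
Qed.

Definition holds (P : Prop) : bool := if excluded_middle_informative P then true else false.

Lemma holds_spec (P : Prop) : holds P = true <-> P.
Proof. unfold holds. destruct (excluded_middle_informative P); intuition discriminate. Qed.

(** By the s-m-n property there is a program, computable from [z], that ignores
    its input and searches for a witness; it halts on its own index exactly when
    a witness exists. *)
Lemma decidable_halting (phi : nat -> partial_fun nat nat) (b : nat -> nat -> bool)
    {E} (G : context E) (z : E -> nat) :
  acceptable phi ->
  (forall E (D : context E) z t, recursive D z -> recursive D t ->
     decidable D (fun e => b (z e) (t e))) ->
  sequence G (fun _ => halting phi) -> recursive G z ->
  decidable G (fun e => holds (exists t, b (z e) t = true)).
Proof.
  intros Hphi Hb Hh Hz.
  destruct (parametrized_search phi (fun z _ t => b z t) (fun _ _ _ => 0) Hphi)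
    as [s [Hs [H1 H2]]].
  { apply Hb; solve_recursive. }
  { apply recursive_const. }
  apply (recursive_ext _ (fun e => halting phi (s (z e)))).
  - intros e. unfold halting, holds.
    destruct (excluded_middle_informative (exists m, phi (s (z e)) (s (z e)) m)) as [Hm|Hm];
      destruct (excluded_middle_informative (exists t, b (z e) t = true)) as [Ht|Ht];
      try reflexivity; exfalso.
    + destruct Hm as [m Hm]. exact (Ht (H2 _ _ _ Hm)).
    + apply Hm. exists 0. exact (H1 (z e) (s (z e)) Ht).
  - apply (recursive_seq G (fun _ => halting phi)); [exact Hh|].
    apply recursive_computable_seq; assumption.
Qed.

(** A step counter for the numbering: [T i n s] is [S m] or [0] as in
    [steps]. *)
Record simulation (phi : nat -> partial_fun nat nat) (T : nat -> nat -> nat -> nat) :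
  Prop := {
  simulation_sound : forall i n s m, T i n s = S m -> phi i n m;
  simulation_complete : forall i n m, phi i n m ->
    exists s, forall t, s <= t -> T i n t = S m;
  simulation_recursive : forall E (G : context E) i n s,
    recursive G i -> recursive G n -> recursive G s ->
    recursive G (fun e => T (i e) (n e) (s e))
}.

Lemma simulation_exists (phi : nat -> partial_fun nat nat) :
  acceptable phi -> exists T, simulation phi T.
Proof.
  intros [[u Hu] _]. exists (fun i n s => steps u s [i; n]). split.
  - intros i n s m H. apply Hu. exact (steps_sound _ _ _ _ H).
  - intros i n m H. apply steps_complete, Hu, H.
  - intros E G i n s Hi Hn Hs. apply (recursive_steps u E G s [i; n] Hs).
    repeat constructor; assumption.
Qed.

(** [S m] if program [i] has value [m] at [n], and [0] if it is undefined
    there: the halting problem is asked first, so the search always ends. *)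
Definition value (T : nat -> nat -> nat -> nat) (i n : nat) : nat :=
  T i n (least (fun s =>
    negb (holds (exists s, 0 <? T i n s = true)) || (0 <? T i n s))).

Lemma value_search_total (T : nat -> nat -> nat -> nat) (i n : nat) :
  exists s, negb (holds (exists s, 0 <? T i n s = true)) || (0 <? T i n s) = true.
Proof.
  destruct (holds _) eqn:H; [|exists 0; reflexivity].
  apply (proj1 (holds_spec _)) in H. destruct H as [s Hs]. exists s. exact Hs.
Qed.

Lemma value_spec (phi : nat -> partial_fun nat nat) (T : nat -> nat -> nat -> nat) :
  simulation phi T -> forall i n m, value T i n = S m <-> phi i n m.
Proof.
  intros HT i n m. split; [apply (simulation_sound _ _ HT)|]. intros H.
  destruct (simulation_complete _ _ HT _ _ _ H) as [s Hs].
  assert (Hex : holds (exists s, 0 <? T i n s = true) = true).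
  { apply holds_spec. exists s. rewrite Hs by lia. reflexivity. }
  unfold value. destruct (least_spec _ (value_search_total T i n)) as [H1 _].
  set (t := least _) in *. rewrite Hex in H1. apply Nat.ltb_lt in H1.
  destruct (T i n t) as [|m'] eqn:Hm; [lia|].
  apply (simulation_sound _ _ HT) in Hm.
  rewrite (pgraph_functional _ _ _ _ _ _ Hm H). reflexivity.
Qed.

Lemma recursive_value (phi : nat -> partial_fun nat nat) (T : nat -> nat -> nat -> nat)
    {E} (G : context E) (i n : E -> nat) :
  acceptable phi -> simulation phi T -> sequence G (fun _ => halting phi) ->
  recursive G i -> recursive G n -> recursive G (fun e => value T (i e) (n e)).
Proof.
  intros Hphi HT Hh Hi Hn.
  assert (Hd : decidable G (fun e => holds (exists s, 0 <? T (i e) (n e) s = true))).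
  { apply (decidable_ext _ (fun e => holds (exists s,
             0 <? T (left (pairing (i e) (n e))) (right (pairing (i e) (n e))) s = true))).
    { intros e. rewrite left_pairing, right_pairing. reflexivity. }
    apply (decidable_halting phi (fun z s => 0 <? T (left z) (right z) s));
      [exact Hphi| |exact Hh|solve_recursive].
    intros F D z s Hz Hs. solve_recursive.
    apply (simulation_recursive _ _ HT _ D (fun e => left (z e)) (fun e => right (z e)) s);
      solve_recursive. }
  unfold value.
  apply (simulation_recursive _ _ HT _ G i n); [exact Hi|exact Hn|].
  solve_recursive; [intros e; apply value_search_total|].
  apply (simulation_recursive _ _ HT _ (extend G) (fun e => i (fst e))
           (fun e => n (fst e)));
    solve_recursive.
Qed.

Ltac solve_simulated ::=
  match goal with
  | HT : simulation _ ?T |- recursive ?G (fun e => ?T (@?i e) (@?n e) (@?s e)) =>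
      apply (simulation_recursive _ _ HT _ G i n s); solve_recursive
  | Hphi : acceptable _, HT : simulation _ ?T
    |- recursive ?G (fun e => value ?T (@?i e) (@?n e)) =>
      apply (recursive_value _ T G i n Hphi HT); solve_recursive
  end.

(** * Limits *)

(** Here [b x k] tests candidate [x] at stage [k], and a candidate that passes
    every stage is a solution; [guess b n] is the least candidate not refuted
    before stage [n]. *)
Definition guess (b : nat -> nat -> bool) (n : nat) : nat :=
  least (fun x => all_below n (b x)).

Definition is_solution (b : nat -> nat -> bool) (x : nat) : Prop :=
  forall k, b x k = true.

Definition is_least_solution (b : nat -> nat -> bool) (x : nat) : Prop :=
  is_solution b x /\ forall y, is_solution b y -> x <= y.

Definition stabilizes (q : baire) (x : nat) : Prop :=
  exists N, forall n, N <= n -> q n = x.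

Lemma least_solution_exists (b : nat -> nat -> bool) :
  (exists x, is_solution b x) -> exists x, is_least_solution b x.
Proof.
  intros [x Hx]. destruct (least_spec (fun x => holds (is_solution b x))) as [H1 H2].
  { exists x. apply holds_spec, Hx. }
  exists (least (fun x => holds (is_solution b x))). split; [apply holds_spec, H1|].
  intros y Hy. apply Nat.nlt_ge. intros Hlt. specialize (H2 y Hlt).
  rewrite (proj2 (holds_spec _) Hy) in H2. discriminate.
Qed.

Lemma guess_total (b : nat -> nat -> bool) (x n : nat) :
  is_solution b x -> exists y, all_below n (b y) = true.
Proof. intros Hx. exists x. apply all_below_spec. intros k _. apply Hx. Qed.

Lemma guess_le (b : nat -> nat -> bool) (x n : nat) : is_solution b x -> guess b n <= x.
Proof.
  intros Hx. destruct (least_spec _ (guess_total b x n Hx)) as [_ H].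
  apply Nat.nlt_ge. intros Hlt. specialize (H x Hlt).
  apply not_true_iff_false in H. apply H, all_below_spec. intros k _. apply Hx.
Qed.

(** Each of the finitely many candidates below the least solution fails at some
    stage. *)
Lemma guess_stabilizes (b : nat -> nat -> bool) (x : nat) :
  is_least_solution b x -> stabilizes (guess b) x.
Proof.
  intros [Hx Hmin].
  destruct (bound_below x (fun y n => all_below n (b y) = false)) as [N HN].
  { intros y Hy.
    assert (Hk : exists k, b y k <> true).
    { apply not_all_ex_not. intros H. specialize (Hmin y H). lia. }
    destruct Hk as [k Hk]. exists (S k). intros n Hn. apply not_true_iff_false.
    rewrite all_below_spec. intros H. apply Hk, H. exact Hn. }
  exists N. intros n Hn. apply least_eq.
  - apply all_below_spec. intros k _. apply Hx.
  - intros y Hy. exact (HN y n Hy Hn).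
Qed.

Lemma sequence_guess {E} (G : context E) (b : E -> nat -> nat -> bool) :
  (forall e, exists x, is_solution (b e) x) ->
  decidable (extend (extend G)) (fun e => b (fst (fst e)) (snd (fst e)) (snd e)) ->
  sequence G (fun e => guess (b e)).
Proof.
  intros Hex Hb.
  apply (recursive_least (extend G) (fun e x => all_below (snd e) (b (fst e) x))).
  - intros e. destruct (Hex (fst e)) as [x Hx]. exact (guess_total _ x _ Hx).
  - apply (decidable_all_below _ _ (fun e k => b (fst (fst e)) (snd e) k)).
    + solve_recursive.
    + (* the bound [n] sits between the environment and the candidate *)
      apply (recursive_subst _ (extend (extend G))
               (fun e => (fst (fst (fst e)), snd (fst e), snd e))
               (fun e => Nat.b2n (b (fst (fst e)) (snd (fst e)) (snd e)))); [|exact Hb].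
      apply (substitution_extend _ _ (fun e => (fst (fst (fst e)), snd (fst e))) snd);
        [|solve_recursive].
      apply (substitution_extend _ G (fun e => fst (fst (fst e))) (fun e => snd (fst e)));
        [|solve_recursive].
      exact (substitution_weaken _ _ _ (substitution_weaken _ _ _
               (substitution_weaken _ _ _ (substitution_id G)))).
Qed.

(** The finitely many exceptional values are hard-wired into the program, one
    per induction step. *)
Lemma stabilizing_computable (q : baire) (x : nat) : stabilizes q x -> computable_seq q.
Proof.
  intros [N HN]. revert q HN. induction N as [|N IH]; intros q HN.
  - destruct (recursive_const (extend empty_context) x) as [c Hc]. exists c.
    intros n. rewrite (HN n) by lia. exact (Hc (tt, n)).
  - destruct (IH (fun n => q (S n))) as [c Hc]; [intros n Hn; apply HN; lia|].
    destruct (recursive_const empty_context (q 0)) as [d Hd].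
    (* the recursion only distinguishes 0 from successors, whose predecessor is
       the first argument of the body *)
    exists (Prec d (Comp c [Proj 0])). intros n.
    induction n as [|n IHn]; [exact (Hd tt)|].
    exists (q n). split; [exact IHn|]. exists [n].
    split; [split; [reflexivity|exact I]|apply Hc].
Qed.

(** With [z] coding [(i, n)] and [t] coding [(k, s)]: within [s] steps program
    [i] gives different values at [n] and at [n + k]. *)
Definition moves_at (T : nat -> nat -> nat -> nat) (z t : nat) : bool :=
  (0 <? T (left z) (right z) (right t)) &&
  ((0 <? T (left z) (right z + left t) (right t)) &&
   negb (T (left z) (right z) (right t) =? T (left z) (right z + left t) (right t))).

Definition moves (T : nat -> nat -> nat -> nat) (i n : nat) : bool :=
  holds (exists t, moves_at T (pairing i n) t = true).

Definition limit (T : nat -> nat -> nat -> nat) (i : nat) : nat :=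
  Nat.pred (value T i (least (fun n => negb (moves T i n)))).

Lemma moves_spec (phi : nat -> partial_fun nat nat) (T : nat -> nat -> nat -> nat) :
  simulation phi T -> forall q i n, G_map phi q i ->
  moves T i n = false <-> forall m, n <= m -> q m = q n.
Proof.
  intros HT q i n Hi.
  assert (HTq : forall k s, 0 <? T i k s = true -> T i k s = S (q k)).
  { intros k s H. apply Nat.ltb_lt in H.
    destruct (T i k s) as [|m] eqn:Hm; [lia|].
    apply (simulation_sound _ _ HT) in Hm.
    rewrite (pgraph_functional _ _ _ _ _ _ Hm (Hi k)). reflexivity. }
  unfold moves. rewrite <- not_true_iff_false, holds_spec. unfold moves_at.
  rewrite left_pairing, right_pairing. split.
  - intros H m Hm. apply NNPP. intros Hne. apply H.
    destruct (simulation_complete _ _ HT _ _ _ (Hi n)) as [s1 H1].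
    destruct (simulation_complete _ _ HT _ _ _ (Hi m)) as [s2 H2].
    exists (pairing (m - n) (s1 + s2)). rewrite left_pairing, right_pairing.
    replace (n + (m - n)) with m by lia. rewrite H1, H2 by lia.
    simpl. apply negb_true_iff, Nat.eqb_neq. congruence.
  - intros H [t Ht]. apply andb_true_iff in Ht. destruct Ht as [Ht1 Ht].
    apply andb_true_iff in Ht. destruct Ht as [Ht2 Ht].
    apply negb_true_iff, Nat.eqb_neq in Ht. apply Ht.
    rewrite (HTq _ _ Ht1), (HTq _ _ Ht2), (H (n + left t)) by lia. reflexivity.
Qed.

Lemma limit_search_total (phi : nat -> partial_fun nat nat) (T : nat -> nat -> nat -> nat) :
  simulation phi T -> forall q x i, stabilizes q x -> G_map phi q i ->
  exists n, negb (moves T i n) = true.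
Proof.
  intros HT q x i [N HN] Hi. exists N. apply negb_true_iff, (moves_spec phi T HT q i N Hi).
  intros m Hm. rewrite !HN by lia. reflexivity.
Qed.

Lemma limit_spec (phi : nat -> partial_fun nat nat) (T : nat -> nat -> nat -> nat) :
  simulation phi T -> forall q x i, stabilizes q x -> G_map phi q i -> limit T i = x.
Proof.
  intros HT q x i Hq Hi. unfold limit.
  destruct (least_spec _ (limit_search_total phi T HT q x i Hq Hi)) as [H _].
  set (n := least _) in *. apply negb_true_iff in H.
  pose proof (proj1 (moves_spec phi T HT q i n Hi) H) as Hn. clear H.
  rewrite (proj2 (value_spec phi T HT i n (q n)) (Hi n)). simpl.
  destruct Hq as [N HN]. rewrite <- (Hn (n + N)) by lia. apply HN. lia.
Qed.

Lemma recursive_limit (phi : nat -> partial_fun nat nat) (T : nat -> nat -> nat -> nat)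
    {E} (G : context E) (i : E -> nat) :
  acceptable phi -> simulation phi T -> sequence G (fun _ => halting phi) ->
  (forall e, exists n, negb (moves T (i e) n) = true) ->
  recursive G i -> recursive G (fun e => limit T (i e)).
Proof.
  intros Hphi HT Hh Hex Hi.
  apply recursive_pred.
  apply (recursive_value phi T G i (fun e => least (fun n => negb (moves T (i e) n))));
    try assumption.
  solve_recursive; [exact Hex|].
  apply (decidable_halting phi (moves_at T));
    [exact Hphi| |exact (sequence_weaken _ _ Hh)|solve_recursive].
  intros F D z t Hz Ht. unfold moves_at. solve_recursive.
Qed.

(** * Reductions between problems with natural number solutions *)

(** Computability is only demanded on the domain of a partial function, so
    cutting [F] down to the inputs that occur in a reduction is what makes it
    computable. *)
Definition restrict (A : baire -> Prop) (F : baire -> baire) : partial_fun baire baire.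
Proof.
  refine (PartialFun baire baire (fun p r => A p /\ r = F p) _).
  intros p r r' [_ ->] [_ ->]. reflexivity.
Defined.

Definition on_domain (q : baire) (A : baire -> Prop) : context {p : baire | A p} :=
  Context (fun e => join q (proj1_sig e)) [].

Lemma computable_rel_restrict (q : baire) (A : baire -> Prop) (F : baire -> baire) :
  sequence (on_domain q A) (fun e => F (proj1_sig e)) -> computable_rel q (restrict A F).
Proof.
  intros [c Hc]. exists c. intros p r [Hp ->] n. exact (Hc (exist _ p Hp, n)).
Qed.

Lemma join_even (p q : baire) (n : nat) : join p q (n + n) = p n.
Proof.
  unfold join. replace (n + n) with (2 * n) by lia.
  rewrite Nat.even_even, Nat.div2_double. reflexivity.
Qed.

Lemma join_odd (p q : baire) (n : nat) : join p q (S (n + n)) = q n.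
Proof.
  unfold join. replace (n + n) with (2 * n) by lia.
  rewrite Nat.even_succ, Nat.odd_even, Nat.div2_succ_double. reflexivity.
Qed.

Lemma sequence_join {E} (G : context E) (p q : E -> baire) :
  sequence G (fun e => join (p e) (q e)) -> sequence G p /\ sequence G q.
Proof.
  intros H. apply sequence_weaken in H. split.
  - apply (recursive_ext _ (fun e => join (p (fst e)) (q (fst e)) (snd e + snd e))).
    + intros e. apply join_even.
    + apply (recursive_seq (extend G) (fun e => join (p (fst e)) (q (fst e)))); [exact H|].
      solve_recursive.
  - apply (recursive_ext _ (fun e => join (p (fst e)) (q (fst e)) (S (snd e + snd e)))).
    + intros e. apply join_odd.
    + apply (recursive_seq (extend G) (fun e => join (p (fst e)) (q (fst e)))); [exact H|].
      solve_recursive.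
Qed.

Lemma on_domain_sequences (q : baire) (A : baire -> Prop) :
  sequence (on_domain q A) (fun _ => q) /\
  sequence (on_domain q A) (fun e => proj1_sig e).
Proof. apply sequence_join. exact (sequence_oracle (on_domain q A)). Qed.

Lemma sW_le_intro (q : baire) (f g : baire -> nat -> Prop) (l : baire -> baire)
    (h : nat -> nat) :
  sequence (on_domain q (dom f)) (fun e => l (proj1_sig e)) ->
  recursive (on_domain q (fun r => exists p, dom f p /\ g (l p) (r 0)))
    (fun e => h (proj1_sig e 0)) ->
  (forall p, dom f p -> dom g (l p)) ->
  (forall p m, dom f p -> g (l p) m -> f p (h m)) ->
  sW_le q (problem_of baire_space nat_space f) (problem_of baire_space nat_space g).
Proof.
  intros Hl Hh Hdom Hsol.
  exists (restrict (fun r => exists p, dom f p /\ g (l p) (r 0)) (fun r _ => h (r 0))),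
    (restrict (dom f) l).
  split; [apply computable_rel_restrict; unfold sequence; weaken; exact Hh|].
  split; [apply computable_rel_restrict; exact Hl|].
  intros Gam HGam p x -> Hp.
  destruct (HGam (l p) (l p) eq_refl (Hdom p Hp)) as [m [[r [Hr ->]] Hm]].
  exists (h (r 0)). split; [|exact (Hsol p _ Hp Hm)].
  exists (fun _ => h (r 0)). split; [|reflexivity].
  exists r. split.
  - exists (l p). split; [split; [exact Hp|reflexivity]|exact Hr].
  - split; [exists p; split; assumption|reflexivity].
Qed.

(** The inner map sends an instance to itself; the outer one receives the
    instance [p] along with the solution [m]. *)
Lemma W_le_intro (q : baire) (f g : baire -> nat -> Prop) (h : baire -> nat -> nat) :
  (forall E (G : context E) (p : E -> baire) (m : E -> nat),
     sequence G (fun _ => q) -> sequence G p -> recursive G m ->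
     (forall e, dom f (p e) /\ g (p e) (m e)) -> recursive G (fun e => h (p e) (m e))) ->
  (forall p, dom f p -> dom g p) ->
  (forall p m, dom f p -> g p m -> f p (h p m)) ->
  W_le q (problem_of baire_space nat_space f) (problem_of baire_space nat_space g).
Proof.
  intros Hh Hdom Hsol.
  pose (A := fun w => exists p r, w = join p r /\ dom f p /\ g p (r 0)).
  pose (first := fun (w : baire) n => w (n + n)).
  assert (Hfirst : forall p r, first (join p r) = p).
  { intros p r. apply functional_extensionality. intros n. apply join_even. }
  exists (restrict A (fun w _ => h (first w) (w 1))), (restrict (dom f) (fun p => p)).
  split; [|split].
  - apply computable_rel_restrict. destruct (on_domain_sequences q A) as [Hq Hw].
    unfold sequence. weaken.
    apply (Hh _ _ (fun e => first (proj1_sig e)) (fun e => proj1_sig e 1) Hq).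
    + apply (recursive_seq (extend (on_domain q A)) (fun e => proj1_sig (fst e))
               (fun e => snd e + snd e)); [weaken; exact Hw|solve_recursive].
    + apply (recursive_seq (on_domain q A) (fun e => proj1_sig e) (fun _ => 1));
        [exact Hw|apply recursive_const].
    + intros [w [p [r [-> [Hp Hr]]]]]. simpl proj1_sig. rewrite Hfirst.
      split; [exact Hp|exact Hr].
  - apply computable_rel_restrict. apply on_domain_sequences.
  - intros Gam HGam p x -> Hp.
    destruct (HGam p p eq_refl (Hdom p Hp)) as [m [[r [Hr ->]] Hm]].
    exists (h p (r 0)). split; [|exact (Hsol p _ Hp Hm)].
    exists (fun _ => h p (r 0)). split; [|reflexivity].
    exists (join p r). split.
    + exists r. split; [|reflexivity]. exists p.
      split; [split; [exact Hp|reflexivity]|exact Hr].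
    + split; [exists p, r; split; [reflexivity|split; assumption]|].
      rewrite Hfirst. reflexivity.
Qed.

(** * Least solutions from G, K and closed choice *)

(** The instance passed on is the sequence of guesses for [p]. It is eventually
    constant, hence computable, and every index of it, least or not, determines
    its limit, so the solution can be recovered without access to [p]. *)
Lemma sW_le_by_limit (phi : nat -> partial_fun nat nat)
    (f g : baire -> nat -> Prop) (b : baire -> nat -> nat -> bool) :
  acceptable phi ->
  (forall p, dom f p -> exists x, is_least_solution (b p) x /\ f p x) ->
  sequence (on_domain (halting phi) (dom f)) (fun e => guess (b (proj1_sig e))) ->
  (forall q, dom (G_map phi) q -> dom g q) ->
  (forall q i, g q i -> G_map phi q i) ->
  sW_le (halting phi) (problem_of baire_space nat_space f)
    (problem_of baire_space nat_space g).
Proof.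
  intros Hphi Hf Hseq Hdom Hg. destruct (simulation_exists phi Hphi) as [T HT].
  apply (sW_le_intro _ f g (fun p => guess (b p)) (limit T)).
  - exact Hseq.
  - set (A := fun r : baire => _).
    destruct (on_domain_sequences (halting phi) A) as [Hh Hr].
    apply (recursive_limit phi T _ (fun e => proj1_sig e 0) Hphi HT Hh).
    + intros [r [p [Hp Hi]]]. destruct (Hf p Hp) as [x [Hx _]].
      exact (limit_search_total phi T HT _ x _ (guess_stabilizes _ _ Hx) (Hg _ _ Hi)).
    + apply (recursive_seq (on_domain (halting phi) A) (fun e => proj1_sig e) (fun _ => 0));
        [exact Hr|apply recursive_const].
  - intros p Hp. destruct (Hf p Hp) as [x [Hx _]].
    apply Hdom, (dom_G phi Hphi), (stabilizing_computable _ x), guess_stabilizes, Hx.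
  - intros p i Hp Hi. destruct (Hf p Hp) as [x [Hx Hfx]].
    rewrite (limit_spec phi T HT _ x i (guess_stabilizes _ _ Hx) (Hg _ _ Hi)).
    exact Hfx.
Qed.

(** The number [x] stands for the claim that the guesses equal [left x] from
    stage [x] on. At stage [t] the claim [left t] is tested and, if it fails,
    [S (left t)] is enumerated. Every claim comes up at infinitely many stages,
    so it is never refuted only if [left x] is the limit. The shift by one
    reserves [0] as the harmless output of the other stages. *)
Lemma sW_le_C_N (q : baire) (f : baire -> nat -> Prop) (b : baire -> nat -> nat -> bool) :
  (forall p, dom f p -> exists x, is_least_solution (b p) x /\ f p x) ->
  sequence (on_domain q (dom f)) (fun e => guess (b (proj1_sig e))) ->
  sW_le q (problem_of baire_space nat_space f) C_N_problem.
Proof.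
  intros Hf Hseq.
  assert (Hge : forall t, left t <= t).
  { intros t. pose proof (pairing_ge (left t) (right t)). rewrite pairing_left_right in *.
    lia. }
  apply (sW_le_intro q f C_N_map
    (fun p t => if guess (b p) t =? left (left t) then 0 else S (left t))
    (fun m => left (Nat.pred m))).
  - unfold sequence. solve_recursive.
  - apply recursive_left, recursive_pred.
    apply (recursive_seq _ (fun e => proj1_sig e) (fun _ => 0));
      [apply on_domain_sequences|apply recursive_const].
  - intros p Hp. destruct (Hf p Hp) as [x [Hx _]].
    destruct (guess_stabilizes _ _ Hx) as [N HN]. exists (S (pairing x N)). intros t.
    destruct (guess (b p) t =? left (left t)) eqn:Ht; [discriminate|].
    intros H. injection H as H. apply Nat.eqb_neq in Ht. apply Ht.
    rewrite H, left_pairing. apply HN.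
    pose proof (Hge t). pose proof (pairing_ge x N). lia.
  - intros p m Hp Hm. destruct (Hf p Hp) as [x [Hx Hfx]].
    destruct (guess_stabilizes _ _ Hx) as [N HN].
    destruct m as [|m].
    + exfalso. apply (Hm (pairing (pairing x 0) N)). rewrite !left_pairing, HN.
      * rewrite Nat.eqb_refl. reflexivity.
      * apply pairing_ge.
    + replace (left (Nat.pred (S m))) with x; [exact Hfx|]. simpl.
      specialize (Hm (pairing m N)). cbv beta in Hm. rewrite left_pairing, HN in Hm.
      * destruct (Nat.eqb_spec x (left m)) as [H|H]; [exact H|]. destruct (Hm eq_refl).
      * apply pairing_ge.
Qed.

Definition misses (p : baire) (x k : nat) : bool := negb (p k =? x).

Lemma misses_solution (p : baire) (x : nat) : is_solution (misses p) x <-> C_N_map p x.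
Proof.
  split; intros H k; specialize (H k); unfold misses in *.
  - apply Nat.eqb_neq, negb_true_iff, H.
  - apply negb_true_iff, Nat.eqb_neq, H.
Qed.

Definition matches (T : nat -> nat -> nat -> nat) (p : baire) (i k : nat) : bool :=
  value T i k =? S (p k).

Lemma matches_solution (phi : nat -> partial_fun nat nat) (T : nat -> nat -> nat -> nat) :
  simulation phi T -> forall p i, is_solution (matches T p) i <-> G_map phi p i.
Proof.
  intros HT p i.
  split; intros H n; specialize (H n); unfold matches in *.
  - apply (value_spec phi T HT), Nat.eqb_eq, H.
  - apply Nat.eqb_eq, (value_spec phi T HT), H.
Qed.

Lemma matches_least_solution (phi : nat -> partial_fun nat nat)
    (T : nat -> nat -> nat -> nat) :
  simulation phi T -> forall p i, is_least_solution (matches T p) i <-> K_map phi p i.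
Proof.
  intros HT p i. unfold is_least_solution, K_map.
  rewrite (matches_solution phi T HT). split; intros [H1 H2]; (split; [exact H1|]);
    intros j Hj; apply H2, (matches_solution phi T HT), Hj.
Qed.

Lemma sequence_guess_matches (phi : nat -> partial_fun nat nat)
    (T : nat -> nat -> nat -> nat) (A : baire -> Prop) :
  acceptable phi -> simulation phi T -> (forall p, A p -> dom (G_map phi) p) ->
  sequence (on_domain (halting phi) A) (fun e => guess (matches T (proj1_sig e))).
Proof.
  intros Hphi HT HA. destruct (on_domain_sequences (halting phi) A) as [Hh Hp].
  apply sequence_guess.
  - intros [p H]. destruct (HA p H) as [i Hi]. exists i.
    apply (matches_solution phi T HT), Hi.
  - unfold matches. solve_recursive.
Qed.

(** * Bounds and Kolmogorov complexity *)

Lemma K_ge_le_B (phi : nat -> partial_fun nat nat) :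
  acceptable phi -> sW_le (halting phi) (K_ge_problem phi) B_problem.
Proof.
  intros Hphi. destruct (simulation_exists phi Hphi) as [T HT].
  apply (sW_le_intro _ (K_ge_map phi) B_map (fun p => guess (matches T p)) (fun m => m)).
  - apply (sequence_guess_matches phi T); [exact Hphi|exact HT|].
    intros p. apply dom_K_ge.
  - apply (recursive_seq _ (fun e => proj1_sig e) (fun _ => 0));
      [apply on_domain_sequences|apply recursive_const].
  - intros p Hp. apply dom_K_ge in Hp. destruct Hp as [i Hi]. exists i. intros n.
    apply guess_le, (matches_solution phi T HT), Hi.
  - intros p m Hp Hm. apply dom_K_ge, dom_K in Hp. destruct Hp as [k Hk].
    exists k. split; [exact Hk|].
    destruct (guess_stabilizes _ _ (proj2 (matches_least_solution phi T HT p k) Hk))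
      as [N HN].
    rewrite <- (HN N) by lia. apply Hm.
Qed.

Definition new_record (p : baire) (n : nat) : bool := all_below n (fun k => p k <? p n).

(** Values are shifted by one in [value], so at a record this exceeds the values
    of all programs with index at most [p n]. *)
Definition escaping (T : nat -> nat -> nat -> nat) (p : baire) : baire :=
  fun n =>
    if new_record p n
    then least (fun y => all_below (S (p n)) (fun i => value T i n <=? y))
    else 0.

Lemma escaping_search_total (T : nat -> nat -> nat -> nat) (p : baire) (n : nat) :
  exists y, all_below (S (p n)) (fun i => value T i n <=? y) = true.
Proof.
  destruct (bound_below (S (p n)) (fun i y => value T i n <= y)) as [y Hy].
  - intros i _. exists (value T i n). auto.
  - exists y. apply all_below_spec. intros i Hi. apply Nat.leb_le, Hy; auto.
Qed.

Lemma sequence_escaping (phi : nat -> partial_fun nat nat) (T : nat -> nat -> nat -> nat)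
    {E} (G : context E) (p : E -> baire) :
  acceptable phi -> simulation phi T -> sequence G (fun _ => halting phi) ->
  sequence G p -> sequence G (fun e => escaping T (p e)).
Proof.
  intros Hphi HT Hh Hp. unfold sequence, escaping, new_record. solve_recursive.
  intros e. apply escaping_search_total.
Qed.

(** After a place where [p] is maximal there are no new records. *)
Lemma escaping_computable (T : nat -> nat -> nat -> nat) (p : baire) :
  dom B_map p -> computable_seq (escaping T p).
Proof.
  intros [m Hm]. apply (stabilizing_computable _ 0).
  assert (Hmax : exists N, forall n, p n <= p N).
  { clear T. revert Hm. induction m as [|m IH]; intros Hm.
    - exists 0. intros n. specialize (Hm n). lia.
    - destruct (excluded_middle_informative (exists N, p N = S m)) as [[N HN]|H].
      + exists N. rewrite HN. exact Hm.
      + apply IH. intros n. specialize (Hm n).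
        destruct (Nat.eq_dec (p n) (S m)) as [Hn|Hn]; [destruct H; eauto|lia]. }
  destruct Hmax as [N HN]. exists (S N). intros n Hn. unfold escaping.
  destruct (new_record p n) eqn:Hrec; [|reflexivity].
  unfold new_record in Hrec. rewrite all_below_spec in Hrec.
  specialize (Hrec N Hn). apply Nat.ltb_lt in Hrec. specialize (HN n). lia.
Qed.

(** If [i <= p n] for some [n], then the first such [n] is a record, and there
    the sequence differs from program [i]. *)
Lemma escaping_index (phi : nat -> partial_fun nat nat) (T : nat -> nat -> nat -> nat) :
  simulation phi T -> forall p i, G_map phi (escaping T p) i -> forall n, p n < i.
Proof.
  intros HT p i Hi n. apply Nat.nle_gt. intros Hle.
  destruct (least_spec (fun n => i <=? p n)) as [H1 H2].
  { exists n. apply Nat.leb_le, Hle. }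
  set (r := least _) in *. apply Nat.leb_le in H1.
  pose proof (proj2 (value_spec phi T HT i r _) (Hi r)) as Hv. unfold escaping in Hv.
  replace (new_record p r) with true in Hv.
  - destruct (least_spec _ (escaping_search_total T p r)) as [H _].
    set (y := least _) in *. rewrite all_below_spec in H. specialize (H i ltac:(lia)).
    apply Nat.leb_le in H. lia.
  - symmetry. apply all_below_spec. intros k Hk. specialize (H2 k Hk).
    apply Nat.leb_gt in H2. apply Nat.ltb_lt. lia.
Qed.

Lemma B_le_K_ge (phi : nat -> partial_fun nat nat) :
  acceptable phi -> sW_le (halting phi) B_problem (K_ge_problem phi).
Proof.
  intros Hphi. destruct (simulation_exists phi Hphi) as [T HT].
  apply (sW_le_intro _ B_map (K_ge_map phi) (escaping T) (fun m => m)).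
  - apply (sequence_escaping phi); [exact Hphi|exact HT|apply on_domain_sequences..].
  - apply (recursive_seq _ (fun e => proj1_sig e) (fun _ => 0));
      [apply on_domain_sequences|apply recursive_const].
  - intros p Hp. apply dom_K_ge, (dom_G phi Hphi), escaping_computable, Hp.
  - intros p m _ [k [[Hk _] Hkm]] n. pose proof (escaping_index phi T HT p k Hk n). lia.
Qed.

(** * From a bound on the index to an index *)

(** The number [z = pairing m a] codes a set of candidate indices among
    [0, ..., m]: entry [i] of [a] is [0] if [i] is kept, and otherwise [S w]
    where [w] codes the evidence for discarding [i]. *)
Definition keeps (z i : nat) : bool := (i <=? left z) && (entry (right z) i =? 0).

(** [w] codes a point and a number of steps within which program [i] gives a
    value there that differs from the one of [p]. *)
Definition disagrees (T : nat -> nat -> nat -> nat) (p : baire) (i w : nat) : bool :=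
  (0 <? T i (left w) (right w)) && negb (T i (left w) (right w) =? S (p (left w))).

Definition justified (T : nat -> nat -> nat -> nat) (p : baire) (z : nat) : bool :=
  all_below (S (left z)) (fun i =>
    (entry (right z) i =? 0) || disagrees T p i (Nat.pred (entry (right z) i))).

Definition conflict_at (T : nat -> nat -> nat -> nat) (z i j n s : nat) : bool :=
  (keeps z i && keeps z j) &&
  (((0 <? T i n s) && (0 <? T j n s)) && negb (T i n s =? T j n s)).

Definition conflict (T : nat -> nat -> nat -> nat) (z t : nat) : bool :=
  conflict_at T z (left (left t)) (right (left t)) (left (right t)) (right (right t)).

(** A single negative answer of the halting problem certifies this. *)
Definition coherent (T : nat -> nat -> nat -> nat) (z : nat) : bool :=
  negb (holds (exists t, conflict T z t = true)).

Definition pool (T : nat -> nat -> nat -> nat) (p : baire) (m : nat) : nat :=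
  pairing m (least (fun a => justified T p (pairing m a) && coherent T (pairing m a))).

(** The test of the parallel run: [t] codes a kept index and a number of steps
    within which it gives a value at [n]. *)
Definition answers (T : nat -> nat -> nat -> nat) (z n t : nat) : bool :=
  keeps z (left t) && (0 <? T (left t) n (right t)).

Lemma coherent_spec (phi : nat -> partial_fun nat nat) (T : nat -> nat -> nat -> nat) :
  simulation phi T -> forall z, coherent T z = true <->
  forall i j n x y, keeps z i = true -> keeps z j = true ->
    phi i n x -> phi j n y -> x = y.
Proof.
  intros HT z. unfold coherent. rewrite negb_true_iff, <- not_true_iff_false, holds_spec.
  split.
  - intros H i j n x y Hi Hj Hx Hy. apply NNPP. intros Hne. apply H.
    destruct (simulation_complete _ _ HT _ _ _ Hx) as [s1 H1].
    destruct (simulation_complete _ _ HT _ _ _ Hy) as [s2 H2].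
    exists (pairing (pairing i j) (pairing n (s1 + s2))).
    unfold conflict, conflict_at. rewrite !left_pairing, !right_pairing, left_pairing.
    rewrite H1, H2, Hi, Hj by lia. simpl. apply negb_true_iff, Nat.eqb_neq. exact Hne.
  - intros H [t Ht]. unfold conflict, conflict_at in Ht.
    rewrite !andb_true_iff, negb_true_iff, Nat.eqb_neq, !Nat.ltb_lt in Ht.
    destruct Ht as [[Hi Hj] [[Hx Hy] Hne]].
    destruct (T (left (left t)) _ _) as [|x] eqn:H1; [lia|].
    destruct (T (right (left t)) _ _) as [|y] eqn:H2; [lia|].
    apply (simulation_sound _ _ HT) in H1, H2. apply Hne. f_equal.
    exact (H _ _ _ _ _ Hi Hj H1 H2).
Qed.

Lemma justified_keeps (phi : nat -> partial_fun nat nat) (T : nat -> nat -> nat -> nat) :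
  simulation phi T -> forall p z k, justified T p z = true -> G_map phi p k ->
  k <= left z -> keeps z k = true.
Proof.
  intros HT p z k Hz Hk Hle. unfold keeps. apply andb_true_iff.
  split; [apply Nat.leb_le, Hle|].
  unfold justified in Hz. rewrite all_below_spec in Hz. specialize (Hz k ltac:(lia)).
  apply orb_true_iff in Hz. destruct Hz as [Hz|Hz]; [exact Hz|exfalso].
  unfold disagrees in Hz. apply andb_true_iff in Hz. destruct Hz as [H1 H2].
  apply Nat.ltb_lt in H1. apply negb_true_iff, Nat.eqb_neq in H2.
  set (w := Nat.pred _) in *.
  destruct (T k (left w) (right w)) as [|y] eqn:Hy; [lia|].
  apply (simulation_sound _ _ HT) in Hy. apply H2. f_equal.
  exact (pgraph_functional _ _ _ _ _ _ Hy (Hk _)).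
Qed.

(** Discarding every program that differs from [p] somewhere leaves restrictions
    of [p], which cannot contradict each other. *)
Lemma pool_search_total (phi : nat -> partial_fun nat nat) (T : nat -> nat -> nat -> nat) :
  simulation phi T -> forall p m,
  exists a, justified T p (pairing m a) && coherent T (pairing m a) = true.
Proof.
  intros HT p m.
  destruct (entry_choice (S m) (fun i x =>
    (x = 0 \/ disagrees T p i (Nat.pred x) = true) /\
    (x = 0 -> forall n y, phi i n y -> y = p n))) as [a Ha].
  { intros i _.
    destruct (classic (exists w, disagrees T p i w = true)) as [[w Hw]|H].
    - exists (S w). split; [right; exact Hw|discriminate].
    - exists 0. split; [left; reflexivity|]. intros _ n y Hy.
      destruct (simulation_complete _ _ HT _ _ _ Hy) as [s Hs].
      apply NNPP. intros Hne. apply H. exists (pairing n s).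
      unfold disagrees. rewrite left_pairing, right_pairing, Hs by lia. simpl.
      apply negb_true_iff, Nat.eqb_neq. congruence. }
  assert (Hkept : forall i n y, keeps (pairing m a) i = true -> phi i n y -> y = p n).
  { intros i n y Hi. unfold keeps in Hi. rewrite left_pairing, right_pairing in Hi.
    apply andb_true_iff in Hi. destruct Hi as [Hle H0].
    apply Nat.leb_le in Hle. apply Nat.eqb_eq in H0.
    apply (Ha i); [lia|exact H0]. }
  exists a. apply andb_true_iff. split.
  - unfold justified. rewrite left_pairing, right_pairing. apply all_below_spec.
    intros i Hi. apply orb_true_iff. destruct (Ha i Hi) as [[H|H] _].
    + left. apply Nat.eqb_eq, H.
    + right. exact H.
  - apply (coherent_spec phi T HT). intros i j n x y Hi Hj Hx Hy.
    rewrite (Hkept i n x Hi Hx), (Hkept j n y Hj Hy). reflexivity.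
Qed.

(** An index [k] of [p] is never discarded, so at each point some kept program
    answers, and by coherence with [k] every answer is the value of [p]. *)
Lemma answers_spec (phi : nat -> partial_fun nat nat) (T : nat -> nat -> nat -> nat) :
  simulation phi T -> forall p m k n, G_map phi p k -> k <= m ->
  (exists t, answers T (pool T p m) n t = true) /\
  forall t, answers T (pool T p m) n t = true -> T (left t) n (right t) = S (p n).
Proof.
  intros HT p m k n Hk Hle.
  destruct (least_spec _ (pool_search_total phi T HT p m)) as [H _].
  unfold pool. set (a := least _) in *. apply andb_true_iff in H. destruct H as [Hj Hc].
  assert (Hkeep : keeps (pairing m a) k = true).
  { apply (justified_keeps phi T HT p); [exact Hj|exact Hk|].
    rewrite left_pairing. exact Hle. }
  split.
  - destruct (simulation_complete _ _ HT _ _ _ (Hk n)) as [s Hs].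
    exists (pairing k s). unfold answers.
    rewrite left_pairing, right_pairing, Hkeep, Hs by lia. reflexivity.
  - intros t Ht. apply andb_true_iff in Ht. destruct Ht as [Hi Ht].
    apply Nat.ltb_lt in Ht. destruct (T (left t) n (right t)) as [|y] eqn:Hy; [lia|].
    apply (simulation_sound _ _ HT) in Hy. f_equal.
    exact (proj1 (coherent_spec phi T HT _) Hc _ _ _ _ _ Hi Hkeep Hy (Hk n)).
Qed.

Lemma recursive_pool (phi : nat -> partial_fun nat nat) (T : nat -> nat -> nat -> nat)
    {E} (G : context E) (p : E -> baire) (m : E -> nat) :
  acceptable phi -> simulation phi T -> sequence G (fun _ => halting phi) ->
  sequence G p -> recursive G m -> recursive G (fun e => pool T (p e) (m e)).
Proof.
  intros Hphi HT Hh Hp Hm. apply recursive_pairing; [exact Hm|].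
  apply (recursive_least G (fun e a =>
    justified T (p e) (pairing (m e) a) && coherent T (pairing (m e) a))).
  - intros e. apply (pool_search_total phi T HT).
  - apply decidable_andb.
    + unfold justified, disagrees. solve_recursive.
    + apply decidable_negb, (decidable_halting phi (conflict T));
        [exact Hphi| |exact (sequence_weaken _ _ Hh)|solve_recursive].
      intros F D z t Hz Ht. unfold conflict, conflict_at, keeps. solve_recursive.
Qed.

Lemma G_le_K_ge (phi : nat -> partial_fun nat nat) :
  acceptable phi -> W_le (halting phi) (G_problem phi) (K_ge_problem phi).
Proof.
  intros Hphi. destruct (simulation_exists phi Hphi) as [T HT].
  destruct (parametrized_search phi (answers T)
              (fun _ n t => Nat.pred (T (left t) n (right t))) Hphi) as [s [Hs [Hsv _]]].
  { unfold answers, keeps. solve_recursive. }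
  { solve_recursive. }
  apply (W_le_intro _ (G_map phi) (K_ge_map phi) (fun p m => s (pool T p m))).
  - intros E G p m Hh Hp Hm _. apply recursive_computable_seq; [exact Hs|].
    apply (recursive_pool phi); assumption.
  - intros p. apply dom_K_ge.
  - intros p m _ [k [[Hk _] Hkm]] n.
    destruct (answers_spec phi T HT p m k n Hk Hkm) as [Hex Hall].
    destruct (least_spec _ Hex) as [Ht _].
    pose proof (Hsv _ n Hex) as H. rewrite (Hall _ Ht) in H. exact H.
Qed.

Lemma K_ge_le_G (phi : nat -> partial_fun nat nat) :
  W_le (halting phi) (K_ge_problem phi) (G_problem phi).
Proof.
  apply (W_le_intro _ (K_ge_map phi) (G_map phi) (fun _ m => m)).
  - intros E G p m _ _ Hm _. exact Hm.
  - intros p. apply dom_K_ge.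
  - intros p i Hp Hi. apply dom_K_ge, dom_K in Hp. destruct Hp as [k Hk].
    exists k. split; [exact Hk|]. apply Hk, Hi.
Qed.

(** * The equivalences *)

Theorem theorem15 (phi : nat -> partial_fun nat nat) (phi_acceptable : acceptable phi) :
  sW_equiv (halting phi) B_problem (K_ge_problem phi) /\
  W_equiv (halting phi) (K_ge_problem phi) (G_problem phi) /\
  sW_equiv (halting phi) (G_problem phi) (K_problem phi) /\
  sW_equiv (halting phi) (K_problem phi) C_N_problem.
Proof.
  destruct (simulation_exists phi phi_acceptable) as [T HT].
  assert (HK : forall p, dom (G_map phi) p ->
            exists x, is_least_solution (matches T p) x /\ K_map phi p x).
  { intros p Hp. apply dom_K in Hp. destruct Hp as [x Hx]. exists x.
    split; [apply (matches_least_solution phi T HT), Hx|exact Hx]. }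
  assert (HGK : forall q, dom (G_map phi) q -> dom (K_map phi) q).
  { intros q. apply dom_K. }
  assert (HKG : forall q, dom (K_map phi) q -> dom (G_map phi) q).
  { intros q. apply dom_K. }
  split; [split; [apply B_le_K_ge|apply K_ge_le_B]; exact phi_acceptable|].
  split; [split; [apply K_ge_le_G|apply G_le_K_ge; exact phi_acceptable]|].
  split; split.
  - apply (sW_le_by_limit phi _ (K_map phi) (matches T) phi_acceptable).
    + intros p Hp. destruct (HK p Hp) as [x [Hx [Hi _]]]. exists x. split; assumption.
    + apply sequence_guess_matches; auto.
    + exact HGK.
    + intros q i Hi. apply Hi.
  - apply (sW_le_by_limit phi _ (G_map phi) (matches T) phi_acceptable).
    + intros p Hp. apply HK, HKG, Hp.
    + apply sequence_guess_matches; auto.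
    + auto.
    + auto.
  - apply (sW_le_C_N _ _ (matches T)).
    + intros p Hp. apply HK, HKG, Hp.
    + apply sequence_guess_matches; auto.
  - apply (sW_le_by_limit phi C_N_map (K_map phi) misses phi_acceptable).
    + intros p Hp. destruct (least_solution_exists (misses p)) as [x Hx].
      { destruct Hp as [x Hx]. exists x. apply misses_solution, Hx. }
      exists x. split; [exact Hx|]. apply misses_solution, Hx.
    + destruct (on_domain_sequences (halting phi) (dom C_N_map)) as [_ Hp].
      apply sequence_guess.
      * intros [p [x Hx]]. exists x. apply misses_solution, Hx.
      * unfold misses. solve_recursive.
    + exact HGK.
    + intros q i Hi. apply Hi.
Qed.
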